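(* There exists a constant $M_0$ with the following property: if the natural number $t$ has at least $M_0$ maximal blocks of $1$s in its binary expansion, then $c_t>1/2$.
   Context: For a nonnegative integer $n$, $s(n)$ denotes the binary sum of digits of $n$, i.e. the number of digits $1$ in the binary expansion of $n$. For an integer $t\ge 0$, \[c_t=\lim_{N\to\infty}\frac1N\bigl|\{0\le n<N: s(n+t)\ge s(n)\}\bigr|\] (this limit exists). A maximal block of $1$s in the binary expansion $t=\sum_i \varepsilon_i 2^i$ is a maximal run of consecutive digits $\varepsilon_\mu=\dots=\varepsilon_{\mu+\nu-1}=1$ (so $\varepsilon_{\mu+\nu}=0$ and either $\mu=0$ or $\varepsilon_{\mu-1}=0$). *)

(* Defs.v *)
From Stdlib Require Import Reals Arith List.
From Coquelicot Require Import Coquelicot.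
Open Scope R_scope.

(* binary digit i of n (Nat.testbit) ; all digits of index >= n are 0. *)
Definition bsum (n : nat) : nat :=
  length (filter (fun i => Nat.testbit n i) (seq 0 (S n))).

(* number of maximal blocks of 1s in t: indices mu with eps_mu = 1 and
   (mu = 0 or eps_(mu-1) = 0), i.e. starting points of maximal blocks. *)
Definition nblocks (t : nat) : nat :=
  length (filter (fun mu => Nat.testbit t mu &&
                   (Nat.eqb mu 0 || negb (Nat.testbit t (mu - 1))))%bool
                 (seq 0 (S t))).

Definition dens (t N : nat) : R :=
  INR (length (filter (fun n => Nat.leb (bsum n) (bsum (n + t))) (seq 0 N)))
  / INR N.

(* Main.v *)
(* Let X_t have the limiting distribution of s(n+t) - s(n). Its characteristic function gamma_t
   satisfies gamma_{2t} = gamma_t and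
   gamma_{2t+1} = (e^{i th} gamma_t + e^{-i th} gamma_{t+1}) / 2, and Fourier inversion gives
   2 pi (c_t - 1/2) = int_0^pi Im (gamma_t e^{i th/2}) / sin (th/2) d th.

   A Gaussian is not a good enough reference for gamma_t: when t consists of long blocks of 1s
   separated by single 0s, c_t - 1/2 is only of order v^{-3/2}, where v is the variance of X_t.
   In that case X_t is essentially a sum of independent copies of G - 1, with G geometric of
   parameter 1/2, for which the integral above vanishes exactly. So gamma_t is compared with
   r^{v/2} (1 + i W th^3 / 6), where r = e^{-i th} / (2 - e^{i th}) is the characteristic
   function of G - 1 (variance 2, third cumulant 6) and W = 3 v - kappa_3, which is at least 12
   for t >= 1. The averages defining W along the recursion have nonnegative increments, and the error made at each binary digit is bounded by the
   corresponding increment of W times th^4 (up to a logarithm), so that the total error is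
   O(W th^4 + W v th^6). Since |gamma_t| decays like exp (- c N th^2) with the number N of
   blocks, and v is comparable to N, the integral is W v^{-3/2} times a positive constant,
   up to smaller terms. *)
Require Import Defs.
From Stdlib Require Import Reals Arith List ZArith Lra Lia Psatz Bool.
From Coquelicot Require Import Coquelicot.
Open Scope R_scope.

(** * Counting along the binary digits *)

(** The recursion couples t with t + 1, so every quantity is carried as a pair and built by one fold
    over the digits from its values at 0 and 1. Only the mixing operation changes: tail
    probabilities, characteristic functions, cumulants, Fourier kernels. The same recursion yields
    the limit itself, since halving N costs a bounded amount.

    The exponent of r is nu = v / 2 because r has variance 2. With x = nu^(1/18), the integral is
    cut at T = x^(-8) = nu^(-4/9). The cut has to lie above the width nu^(-1/2) of the main term, so
    that the part beyond it is negligible, and below nu^(-5/12), so that the errors W T^4 and W nu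
    T^6 stay below W nu^(-3/2). The exponent 1/18 turns both [sqrt nu] and T into integer powers of
    x, and the logarithm can be bounded crudely by a multiple of x. *)

Definition digit_step {A : Type} (mix : A -> A -> A) (d : bool) (s : A * A) : A * A :=
  if d then (mix (fst s) (snd s), snd s) else (fst s, mix (fst s) (snd s)).

(** Lists hold the least significant digit at the head, so [fold_right] starts from the top digit.
    The state for [value l] = t is the pair attached to t and t + 1, and [s0] is the pair attached
    to 0 and 1. *)
Definition digit_fold {A : Type} (mix : A -> A -> A) (s0 : A * A) (l : list bool) : A * A :=
  fold_right (digit_step mix) s0 l.

Fixpoint value (l : list bool) : nat :=
  match l with
  | nil => 0
  | d :: l' => Nat.b2n d + 2 * value l'
  end.

Lemma value_surj (t : nat) : exists l, value l = t.
Proof.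
  induction t as [t IH] using lt_wf_ind.
  destruct t as [|t]; [now exists nil|].
  destruct (IH (Nat.div2 (S t))) as [l Hl].
  { apply Nat.lt_div2; lia. }
  exists (Nat.odd (S t) :: l). cbn [value]. rewrite Hl.
  pose proof (Nat.div2_odd (S t)). lia.
Qed.

Definition cnt (P : nat -> bool) (N : nat) : nat := length (filter P (seq 0 N)).

Lemma cnt_S (P : nat -> bool) (N : nat) :
  cnt P (S N) = (cnt P N + Nat.b2n (P N))%nat.
Proof.
  unfold cnt. rewrite seq_S, filter_app, length_app. cbn.
  now destruct (P N).
Qed.

Lemma cnt_shift (P : nat -> bool) (N : nat) :
  cnt P (S N) = (Nat.b2n (P 0%nat) + cnt (fun i => P (S i)) N)%nat.
Proof.
  induction N as [|N IH].
  - rewrite cnt_S. unfold cnt; cbn. lia.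
  - rewrite cnt_S, IH, cnt_S. lia.
Qed.

Lemma cnt_ext (P Q : nat -> bool) (N : nat) :
  (forall i, (i < N)%nat -> P i = Q i) -> cnt P N = cnt Q N.
Proof.
  induction N as [|N IH]; intros H; [reflexivity|].
  rewrite !cnt_S, IH by (intros; apply H; lia). now rewrite H by lia.
Qed.

Lemma cnt_le (P : nat -> bool) (N : nat) : (cnt P N <= N)%nat.
Proof.
  induction N as [|N IH]; [cbn; lia|].
  rewrite cnt_S. destruct (P N); cbn; lia.
Qed.

Lemma cnt_double (P : nat -> bool) (N : nat) :
  cnt P (2 * N) = (cnt (fun m => P (2 * m)%nat) N + cnt (fun m => P (2 * m + 1)%nat) N)%nat.
Proof.
  induction N as [|N IH]; [reflexivity|].
  replace (2 * S N)%nat with (S (S (2 * N))) by lia.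
  rewrite !cnt_S, IH. replace (2 * N + 1)%nat with (S (2 * N)) by lia. lia.
Qed.

Lemma cnt_extend (P : nat -> bool) (N k : nat) :
  (forall i, (N <= i)%nat -> P i = false) -> cnt P (N + k) = cnt P N.
Proof.
  intros H. induction k as [|k IH]; [now rewrite Nat.add_0_r|].
  rewrite Nat.add_succ_r, cnt_S, IH, H by lia. cbn; lia.
Qed.

Lemma testbit_large (n i : nat) : (n <= i)%nat -> Nat.testbit n i = false.
Proof.
  intros H. destruct n as [|n]; [apply Nat.bits_0|].
  apply Nat.bits_above_log2.
  apply Nat.lt_le_trans with (S n); [|exact H].
  apply Nat.log2_lt_lin; lia.
Qed.

Lemma testbit_b2n_0 (d : bool) (n : nat) : Nat.testbit (Nat.b2n d + 2 * n) 0 = d.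
Proof. rewrite Nat.add_comm. apply Nat.testbit_0_r. Qed.

Lemma testbit_b2n_S (d : bool) (n i : nat) :
  Nat.testbit (Nat.b2n d + 2 * n) (S i) = Nat.testbit n i.
Proof. rewrite Nat.add_comm. apply Nat.testbit_succ_r. Qed.

Lemma bsum_b2n (d : bool) (n : nat) : bsum (Nat.b2n d + 2 * n) = (Nat.b2n d + bsum n)%nat.
Proof.
  unfold bsum.
  change (cnt (Nat.testbit (Nat.b2n d + 2 * n)) (S (Nat.b2n d + 2 * n)) =
    (Nat.b2n d + cnt (Nat.testbit n) (S n))%nat).
  (* The range of each count depends on the number itself; it is lengthened to a common one, the
     additional digits being 0. *)
  rewrite <- (cnt_extend (Nat.testbit (Nat.b2n d + 2 * n)) (S (Nat.b2n d + 2 * n)) (S n))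
    by (intros; apply testbit_large; lia).
  change (S (Nat.b2n d + 2 * n) + S n)%nat with (S (Nat.b2n d + 2 * n + S n)).
  rewrite cnt_shift, testbit_b2n_0. f_equal.
  replace (Nat.b2n d + 2 * n + S n)%nat with (S n + (Nat.b2n d + 2 * n))%nat by lia.
  rewrite cnt_extend by (intros; rewrite testbit_b2n_S; apply testbit_large; lia).
  apply cnt_ext. intros. apply testbit_b2n_S.
Qed.

Definition block_start (t mu : nat) : bool :=
  (Nat.testbit t mu && (Nat.eqb mu 0 || negb (Nat.testbit t (mu - 1))))%bool.

(** A 1 put below a lowest digit 1 only extends that block downwards: one start disappears and one
    appears. Below a 0 it opens a new block. *)
Lemma nblocks_b2n (d : bool) (t : nat) :
  nblocks (Nat.b2n d + 2 * t) =
  (nblocks t + Nat.b2n (d && negb (Nat.testbit t 0)))%nat.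
Proof.
  change (cnt (block_start (Nat.b2n d + 2 * t)) (S (Nat.b2n d + 2 * t)) =
    (cnt (block_start t) (S t) + Nat.b2n (d && negb (Nat.testbit t 0)))%nat).
  assert (Hbig : forall u i, (u <= i)%nat -> block_start u i = false).
  { intros. unfold block_start. now rewrite testbit_large. }
  rewrite <- (cnt_extend (block_start (Nat.b2n d + 2 * t)) (S (Nat.b2n d + 2 * t)) (S t))
    by (intros; apply Hbig; lia).
  change (S (Nat.b2n d + 2 * t) + S t)%nat with (S (Nat.b2n d + 2 * t + S t)).
  replace (Nat.b2n d + 2 * t + S t)%nat with (S t + (Nat.b2n d + 2 * t))%nat by lia.
  rewrite cnt_shift.
  rewrite cnt_extend by (intros; unfold block_start;
    rewrite testbit_b2n_S, testbit_large by lia; reflexivity).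
  rewrite !cnt_shift.
  rewrite (cnt_ext (fun i => block_start (Nat.b2n d + 2 * t) (S (S i)))
    (fun i => block_start t (S i))).
  2:{ intros i _. unfold block_start. rewrite testbit_b2n_S.
      replace (S (S i) - 1)%nat with (S i) by lia. rewrite testbit_b2n_S.
      now replace (S i - 1)%nat with i by lia. }
  unfold block_start. rewrite testbit_b2n_S. simpl Nat.sub. rewrite testbit_b2n_0.
  cbn [Nat.eqb]. destruct d, (Nat.testbit t 0); cbn; lia.
Qed.

Definition head_digit (l : list bool) : bool :=
  match l with nil => false | d :: _ => d end.

Lemma testbit_value (l : list bool) : Nat.testbit (value l) 0 = head_digit l.
Proof.
  destruct l as [|d l]; [reflexivity|]. apply testbit_b2n_0.
Qed.

(* The number of occurrences of "10" in the usual (most significant first) notation. *)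
Fixpoint descents (l : list bool) : nat :=
  match l with
  | nil => 0
  | d :: l' => descents l' + Nat.b2n (negb d && head_digit l')
  end.

(** Every block lies just above a 0, which gives a descent, except a block that starts at position
    0. *)
Lemma nblocks_descents (l : list bool) :
  (nblocks (value l) <= descents l + Nat.b2n (head_digit l))%nat.
Proof.
  induction l as [|d l IH]; [cbn; lia|].
  cbn [value descents head_digit]. rewrite nblocks_b2n, testbit_value.
  destruct d, (head_digit l); cbn in *; lia.
Qed.

(** * The densities of s(n+t) - s(n) >= j and the existence of their limits *)

Lemma Zleb_ext (a b c d : Z) : (a <= b <-> c <= d)%Z -> Z.leb a b = Z.leb c d.
Proof. intros H. apply eq_true_iff_eq. now rewrite !Z.leb_le. Qed.

Definition excess (t : nat) (j : Z) (n : nat) : bool :=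
  Z.leb (Z.of_nat (bsum n) + j) (Z.of_nat (bsum (n + t))).

Lemma excess_zero (j : Z) (n : nat) : excess 0 j n = Z.leb j 0.
Proof.
  unfold excess. rewrite Nat.add_0_r. apply Zleb_ext. lia.
Qed.

Lemma bsum_even (n : nat) : bsum (2 * n) = bsum n.
Proof. exact (bsum_b2n false n). Qed.

Lemma bsum_odd (n : nat) : bsum (2 * n + 1) = S (bsum n).
Proof. rewrite Nat.add_comm. exact (bsum_b2n true n). Qed.

Lemma excess_even (t : nat) (j : Z) (N : nat) :
  cnt (excess (2 * t) j) (2 * N) = (2 * cnt (excess t j) N)%nat.
Proof.
  rewrite cnt_double.
  rewrite (cnt_ext _ (excess t j)).
  2:{ intros n _. unfold excess. rewrite bsum_even.
      replace (2 * n + 2 * t)%nat with (2 * (n + t))%nat by lia. now rewrite bsum_even. }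
  rewrite (cnt_ext (fun m => excess _ _ (2 * m + 1)) (excess t j)); [lia|].
  intros n _. unfold excess. rewrite bsum_odd.
  replace (2 * n + 1 + 2 * t)%nat with (2 * (n + t) + 1)%nat by lia. rewrite bsum_odd. apply Zleb_ext. lia.
Qed.

(** For n = 2m the sum gains a digit 1 over m + t. For n = 2m + 1 a carry leads to m + t + 1, while
    s(n) itself gains 1. Hence the shifts of j by -1 and +1. *)
Lemma excess_odd (t : nat) (j : Z) (N : nat) :
  cnt (excess (2 * t + 1) j) (2 * N) =
  (cnt (excess t (j - 1)) N + cnt (excess (t + 1) (j + 1)) N)%nat.
Proof.
  rewrite cnt_double. f_equal; apply cnt_ext; intros n _; unfold excess.
  - rewrite bsum_even. replace (2 * n + (2 * t + 1))%nat with (2 * (n + t) + 1)%nat by lia.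
    rewrite bsum_odd. apply Zleb_ext. lia.
  - rewrite bsum_odd. replace (2 * n + 1 + (2 * t + 1))%nat with (2 * (n + (t + 1)))%nat by lia.
    rewrite bsum_even. apply Zleb_ext. lia.
Qed.

Definition tail_mix (F G : Z -> R) (j : Z) : R := (F (j - 1)%Z + G (j + 1)%Z) / 2.

Lemma INR_double (n : nat) : INR (2 * n) = 2 * INR n.
Proof. now rewrite mult_INR. Qed.

Lemma INR_double_S (n : nat) : INR (2 * n + 1) = 2 * INR n + 1.
Proof. now rewrite plus_INR, mult_INR. Qed.

Lemma cnt_parity (P : nat -> bool) (N : nat) :
  exists M (r : R), INR N = 2 * INR M + r /\ 0 <= r <= 1 /\
    INR (cnt P (2 * M)) <= INR (cnt P N) <= INR (cnt P (2 * M)) + r.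
Proof.
  exists (Nat.div2 N), (INR (Nat.b2n (Nat.odd N))).
  pose proof (Nat.div2_odd N) as E. set (M := Nat.div2 N) in *.
  destruct (Nat.odd N); cbn [Nat.b2n] in *; rewrite E at 1 2 3; cbn [INR].
  - rewrite plus_INR, mult_INR. cbn [INR]. rewrite Nat.add_1_r, cnt_S, plus_INR.
    repeat split; try lra; destruct (P (2 * M)%nat); cbn [Nat.b2n INR]; lra.
  - rewrite plus_INR, mult_INR, Nat.add_0_r. cbn [INR]. lra.
Qed.

(* The error is halved, up to an additive constant, at each halving of [N], so
   the estimate is obtained for every [k] by induction on [k]. *)
Lemma cnt_excess_estimate (c0 c1 : Z -> R) :
  (forall j, c0 j = if Z.leb j 0 then 1 else 0) ->
  (forall j, 0 <= c1 j <= 1) ->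
  (forall j, c1 j = tail_mix c0 c1 j) ->
  forall (k : nat) (l : list bool) (j : Z) (N : nat),
    Rabs (INR (cnt (excess (value l) j) N) - INR N * fst (digit_fold tail_mix (c0, c1) l) j)
      <= INR (value l) * (INR N / 2 ^ k + INR k) /\
    Rabs (INR (cnt (excess (value l + 1) j) N) - INR N * snd (digit_fold tail_mix (c0, c1) l) j)
      <= (INR (value l) + 1) * (INR N / 2 ^ k + INR k).
Proof.
  intros Hc0 Hc1 Hfix.
  assert (Hzero : forall j N, INR (cnt (excess 0 j) N) = INR N * c0 j).
  { intros j N. rewrite Hc0, (cnt_ext _ (fun _ => Z.leb j 0)) by (intros; apply excess_zero).
    induction N as [|N IH]; [cbn; lra|]. rewrite cnt_S, plus_INR, IH, S_INR.
    destruct (Z.leb j 0); cbn; lra. }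
  assert (H01 : forall l j, 0 <= fst (digit_fold tail_mix (c0, c1) l) j <= 1 /\
                       0 <= snd (digit_fold tail_mix (c0, c1) l) j <= 1).
  { induction l as [|d l IH]; intros j.
    - cbn. split; [|apply Hc1]. rewrite Hc0. destruct (Z.leb j 0); lra.
    - cbn. pose proof (IH j). pose proof (IH (j - 1)%Z). pose proof (IH (j + 1)%Z).
      destruct d; cbn; unfold tail_mix, digit_fold in *; lra. }
  intros k. induction k as [|k IH].
  - intros l j N. cbn [pow INR].
    assert (HN : forall P x, 0 <= x <= 1 -> Rabs (INR (cnt P N) - INR N * x) <= INR N).
    { intros P x Hx. pose proof (pos_INR (cnt P N)). pose proof (pos_INR N).
      pose proof (le_INR _ _ (cnt_le P N)). apply Rabs_le. nra. }
    pose proof (pos_INR N). pose proof (pos_INR (value l)). split.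
    + destruct (Nat.eq_dec (value l) 0) as [E|E].
      * assert (E' : forall i, fst (digit_fold tail_mix (c0, c1) l) i = c0 i).
        { clear - E. induction l as [|d l IH]; [reflexivity|]. cbn [value] in E.
          destruct d; cbn in E; [lia|]. intros i. cbn. apply IH. lia. }
        rewrite E, E', Hzero. rewrite Rminus_diag, Rabs_R0. cbn; lra.
      * apply Rle_trans with (INR N); [apply HN, H01|].
        assert (1 <= INR (value l)) by (apply (le_INR 1); lia). nra.
    + apply Rle_trans with (INR N); [apply HN, H01|]. nra.
  (* The loss r for odd N is paid for by the passage from k to k + 1, which needs t >= 1. At t = 0
     the claimed error is 0, and doubling does not change the set. *)
  - assert (Hdbl : forall T T' (x y : Z -> R) t j,
      (forall M, (cnt T' (2 * M) = 2 * cnt T M)%nat) ->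
      y j = x j -> 0 <= x j <= 1 ->
      (t = 0 -> T' = T) ->
      (t = 0 \/ 1 <= t) ->
      (forall N, Rabs (INR (cnt T N) - INR N * x j) <= t * (INR N / 2 ^ k + INR k)) ->
      forall N, Rabs (INR (cnt T' N) - INR N * y j) <= 2 * t * (INR N / 2 ^ S k + INR (S k))).
    { intros T T' x y t j H1 H2 H3 H4 H5 H6 N. rewrite H2.
      destruct H5 as [->|H5].
      { rewrite H4 by reflexivity. specialize (H6 N). lra. }
      destruct (cnt_parity T' N) as (M & r & E & Hr & HP).
      specialize (H6 M). rewrite H1, INR_double in HP.
      apply Rabs_le_between in H6. rewrite E, S_INR. cbn [pow].
      assert (0 < / 2 ^ k) by (apply Rinv_0_lt_compat, pow_lt; lra).
      pose proof (pos_INR M). pose proof (pos_INR k).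
      replace ((2 * INR M + r) / (2 * 2 ^ k)) with (INR M / 2 ^ k + r / 2 * / 2 ^ k)
        by (field; apply pow_nonzero; lra).
      assert (0 <= t * (r / 2 * / 2 ^ k)) by (apply Rmult_le_pos; [lra|]; nra).
      apply Rabs_le. nra. }
    assert (Hmix : forall T T1 T2 (x y : Z -> R) t1 t2 j,
      (forall M, (cnt T (2 * M) = cnt T1 M + cnt T2 M)%nat) ->
      0 <= tail_mix x y j <= 1 -> 1 <= t1 + t2 ->
      (forall N, Rabs (INR (cnt T1 N) - INR N * x (j - 1)%Z) <= t1 * (INR N / 2 ^ k + INR k)) ->
      (forall N, Rabs (INR (cnt T2 N) - INR N * y (j + 1)%Z) <= t2 * (INR N / 2 ^ k + INR k)) ->
      forall N, Rabs (INR (cnt T N) - INR N * tail_mix x y j)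
        <= (t1 + t2) * (INR N / 2 ^ S k + INR (S k))).
    { intros T T1 T2 x y t1 t2 j H1 H2 H3 H4 H5 N.
      destruct (cnt_parity T N) as (M & r & E & Hr & HP).
      specialize (H4 M). specialize (H5 M). rewrite H1, plus_INR in HP.
      apply Rabs_le_between in H4. apply Rabs_le_between in H5. rewrite E, S_INR. cbn [pow].
      assert (0 < / 2 ^ k) by (apply Rinv_0_lt_compat, pow_lt; lra).
      pose proof (pos_INR M). pose proof (pos_INR k).
      replace ((2 * INR M + r) / (2 * 2 ^ k)) with (INR M / 2 ^ k + r / 2 * / 2 ^ k)
        by (field; apply pow_nonzero; lra).
      assert (0 <= (t1 + t2) * (r / 2 * / 2 ^ k)) by (apply Rmult_le_pos; [lra|]; nra).
      assert (Hm : (2 * INR M + r) * tail_mix x y j =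
        INR M * x (j - 1)%Z + INR M * y (j + 1)%Z + r * tail_mix x y j)
        by (unfold tail_mix; field).
      assert (0 <= r * tail_mix x y j <= r) by nra.
      rewrite Hm. apply Rabs_le. nra. }
    assert (Hcase : forall t : nat, INR t = 0 \/ 1 <= INR t).
    { intros [|t]; [left; reflexivity|right]. apply (le_INR 1); lia. }
    intros l j N. destruct l as [|d l].
    + cbn [value digit_fold fold_right fst snd Nat.add]. split.
      * rewrite Hzero, Rminus_diag, Rabs_R0. cbn [INR]. lra.
      * rewrite Hfix. replace (INR 0 + 1) with (0 + 1) by (cbn; ring).
        apply Hmix with (T1 := excess 0 (j - 1)) (T2 := excess 1 (j + 1)).
        -- intros M. exact (excess_odd 0 j M).
        -- rewrite <- Hfix. apply Hc1.
        -- lra.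
        -- intros M. exact (proj1 (IH nil (j - 1)%Z M)).
        -- intros M. pose proof (proj2 (IH nil (j + 1)%Z M)) as H. cbn in H.
           rewrite Rplus_0_l in H. exact H.
    + change (digit_fold tail_mix (c0, c1) (d :: l)) with
        (digit_step tail_mix d (digit_fold tail_mix (c0, c1) l)).
      specialize (H01 l). set (s := digit_fold tail_mix (c0, c1) l) in *.
      assert (Hm01 : 0 <= tail_mix (fst s) (snd s) j <= 1).
      { unfold tail_mix. pose proof (H01 (j - 1)%Z). pose proof (H01 (j + 1)%Z). lra. }
      assert (Hm : forall N, Rabs (INR (cnt (excess (2 * value l + 1) j) N)
          - INR N * tail_mix (fst s) (snd s) j)
          <= (INR (value l) + (INR (value l) + 1)) * (INR N / 2 ^ S k + INR (S k))).
      { apply Hmix with (T1 := excess (value l) (j - 1)) (T2 := excess (value l + 1) (j + 1)).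
        - apply excess_odd.
        - exact Hm01.
        - pose proof (pos_INR (value l)). lra.
        - intros M. apply (IH l (j - 1)%Z M).
        - intros M. apply (IH l (j + 1)%Z M). }
      destruct d; cbn [digit_step fst snd value Nat.b2n].
      * replace (1 + 2 * value l)%nat with (2 * value l + 1)%nat by lia. split.
        -- rewrite INR_double_S.
           replace (2 * INR (value l) + 1) with (INR (value l) + (INR (value l) + 1)) by ring.
           apply Hm.
        -- replace (2 * value l + 1 + 1)%nat with (2 * (value l + 1))%nat by lia.
           rewrite INR_double_S.
           replace (2 * INR (value l) + 1 + 1) with (2 * (INR (value l) + 1)) by ring.
           apply Hdbl with (T := excess (value l + 1) j) (x := snd s).
           ++ intros M. apply excess_even.
           ++ reflexivity.
           ++ apply H01.
           ++ pose proof (pos_INR (value l)). lra.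
           ++ right. pose proof (pos_INR (value l)). lra.
           ++ intros M. apply (IH l j M).
      * rewrite Nat.add_0_l. split.
        -- rewrite INR_double.
           apply Hdbl with (T := excess (value l) j) (x := fst s).
           ++ intros M. apply excess_even.
           ++ reflexivity.
           ++ apply H01.
           ++ intros E. apply (INR_eq _ 0) in E. now rewrite E.
           ++ apply Hcase.
           ++ intros M. apply (IH l j M).
        -- rewrite INR_double.
           replace (2 * INR (value l) + 1) with
             (INR (value l) + (INR (value l) + 1)) by ring.
           apply Hm.
Qed.

Lemma dens_limit (c0 c1 : Z -> R) (l : list bool) :
  (forall j, c0 j = if Z.leb j 0 then 1 else 0) ->
  (forall j, 0 <= c1 j <= 1) ->
  (forall j, c1 j = tail_mix c0 c1 j) ->
  is_lim_seq (dens (value l)) (fst (digit_fold tail_mix (c0, c1) l) 0%Z).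
Proof.
  intros Hc0 Hc1 Hfix.
  pose proof (cnt_excess_estimate c0 c1 Hc0 Hc1 Hfix) as Hest.
  set (c := fst (digit_fold tail_mix (c0, c1) l) 0%Z).
  assert (Hd : forall N, dens (value l) N = INR (cnt (excess (value l) 0) N) / INR N).
  { intros N. unfold dens. do 2 f_equal. apply cnt_ext. intros n _. unfold excess.
    apply eq_true_iff_eq. rewrite Nat.leb_le, Z.leb_le. lia. }
  apply is_lim_seq_spec. intros [eps Heps]. cbn.
  set (t := INR (value l)) in *.
  assert (Ht : 0 <= t) by apply pos_INR.
  (* First k is fixed so that 2^(-k) is small, then N is taken large enough for k / N to be
     small. *)
  destruct (pow_lt_1_zero (/ 2) ltac:(rewrite Rabs_right; lra) (eps / (2 * (t + 1))))
    as [k Hk].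
  { apply Rdiv_lt_0_compat; lra. }
  specialize (Hk k (Nat.le_refl k)).
  rewrite Rabs_right, pow_inv in Hk by (apply Rle_ge, pow_le; lra).
  destruct (archimed_cor1 (eps / (2 * (t + 1) * (INR k + 1)))) as (N0 & HN0 & HN0').
  { pose proof (pos_INR k). apply Rdiv_lt_0_compat; [lra|]. apply Rmult_lt_0_compat; lra. }
  exists N0. intros N HN.
  assert (HNpos : 0 < INR N0 <= INR N) by (split; [apply (lt_INR 0)|apply le_INR]; lia).
  destruct (Hest k l 0%Z N) as [H _]. fold c t in H. rewrite Hd.
  replace (INR (cnt (excess (value l) 0) N) / INR N - c) with
    ((INR (cnt (excess (value l) 0) N) - INR N * c) * / INR N) by (field; lra).
  rewrite Rabs_mult, (Rabs_right (/ INR N))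
    by (apply Rle_ge, Rlt_le, Rinv_0_lt_compat; lra).
  apply Rle_lt_trans with (t * (/ 2 ^ k + INR k * / INR N)).
  { apply Rle_trans with (t * (INR N / 2 ^ k + INR k) * / INR N).
    - apply Rmult_le_compat_r; [apply Rlt_le, Rinv_0_lt_compat; lra|exact H].
    - right. field. split; [lra|apply pow_nonzero; lra]. }
  assert (H1 : (t + 1) * / 2 ^ k <= eps / 2).
  { apply Rle_trans with ((t + 1) * (eps / (2 * (t + 1)))); [nra|right; field; lra]. }
  assert (HiN : 0 < / INR N <= / INR N0).
  { split; [apply Rinv_0_lt_compat; lra|apply Rinv_le_contravar; lra]. }
  assert (Hk0 := pos_INR k).
  assert (H2 : (t + 1) * (INR k * / INR N) <= eps / 2).
  { apply Rle_trans with ((t + 1) * ((INR k + 1) * (eps / (2 * (t + 1) * (INR k + 1))))).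
    - apply Rmult_le_compat_l; [lra|]. apply Rmult_le_compat; lra.
    - right; field; lra. }
  assert (0 < / 2 ^ k) by (apply Rinv_0_lt_compat, pow_lt; lra).
  assert (0 <= INR k * / INR N) by (apply Rmult_le_pos; lra).
  nra.
Qed.

(** Iteration gives D j <= D (j + n) / 2^n, and linear growth loses against 2^n. This is what
    confines the tail probabilities at t = 1 to [0, 1]: their integral formula alone bounds them
    only linearly in j. *)
Lemma nonpos_of_halving (D : Z -> R) (K : R) :
  (forall j, D j <= D (j + 1)%Z / 2) ->
  (forall j, D j <= K * (IZR (Z.abs j) + 1)) ->
  forall j, D j <= 0.
Proof.
  intros Hhalf Hgrow j.
  assert (Hit : forall n, D j <= D (j + Z.of_nat n)%Z / 2 ^ n).
  { induction n as [|n IH]; [rewrite Z.add_0_r; cbn; lra|].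
    apply Rle_trans with (1 := IH). rewrite Nat2Z.inj_succ, <- Z.add_1_r, Z.add_assoc.
    cbn [pow]. assert (0 < / 2 ^ n) by (apply Rinv_0_lt_compat, pow_lt; lra).
    pose proof (Hhalf (j + Z.of_nat n)%Z).
    replace (D (j + Z.of_nat n + 1)%Z / (2 * 2 ^ n)) with
      (D (j + Z.of_nat n + 1)%Z / 2 * / 2 ^ n) by (field; apply pow_nonzero; lra).
    apply Rmult_le_compat_r; lra. }
  assert (HK : 0 <= K * (IZR (Z.abs j) + 1) \/ D j <= 0).
  { destruct (Rle_dec 0 (K * (IZR (Z.abs j) + 1))); [now left|right].
    pose proof (Hgrow j). lra. }
  destruct HK as [HK|HK]; [|exact HK].
  assert (Hj : 1 <= IZR (Z.abs j) + 1) by (assert (0 <= IZR (Z.abs j)) by (apply IZR_le; lia); lra).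
  assert (K0 : 0 <= K) by nra.
  assert (Hlim : is_lim_seq (fun n => K * ((IZR (Z.abs j) + 1) * (/ 2) ^ n + INR n * (/ 2) ^ n)) 0).
  { replace (Finite 0) with (Rbar_mult K (Rbar_plus (Rbar_mult (IZR (Z.abs j) + 1) 0) 0))
      by (cbn; apply (f_equal Finite); ring).
    apply is_lim_seq_scal_l.
    apply is_lim_seq_plus with (Rbar_mult (IZR (Z.abs j) + 1) 0) 0.
    - apply is_lim_seq_scal_l, is_lim_seq_geom. rewrite Rabs_right; lra.
    - apply is_lim_seq_le_le with (fun _ => 0) (fun n => 2 * (3 / 4) ^ n).
      + intros n. split; [apply Rmult_le_pos; [apply pos_INR|apply pow_le; lra]|].
        induction n as [|n IH]; [cbn; lra|]. rewrite S_INR. cbn [pow].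
        assert (Hp : (/ 2) ^ n <= (3 / 4) ^ n) by (apply pow_incr; lra).
        assert (0 < (/ 2) ^ n) by (apply pow_lt; lra). nra.
      + apply is_lim_seq_const.
      + replace (Finite 0) with (Rbar_mult 2 0) by (cbn; apply (f_equal Finite); ring).
        apply is_lim_seq_scal_l, is_lim_seq_geom. rewrite Rabs_right; lra.
    - reflexivity. }
  apply (is_lim_seq_le (fun _ => D j) _ (D j) 0) in Hlim; [exact Hlim| |apply is_lim_seq_const].
  intros n. apply Rle_trans with (1 := Hit n).
  unfold Rdiv. rewrite <- pow_inv.
  apply Rle_trans with (K * (IZR (Z.abs j) + 1 + INR n) * (/ 2) ^ n).
  - apply Rmult_le_compat_r; [apply pow_le; lra|].
    apply Rle_trans with (1 := Hgrow _). apply Rmult_le_compat_l; [exact K0|].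
    rewrite INR_IZR_INZ. rewrite <- !plus_IZR. apply IZR_le. lia.
  - right. ring.
Qed.

(** * The characteristic function and its decay *)

Definition cis (x : R) : C := (cos x, sin x).

Lemma cis_add (x y : R) : cis (x + y) = (cis x * cis y)%C.
Proof.
  unfold cis, Cmult; cbn. rewrite cos_plus, sin_plus. f_equal; ring.
Qed.

Lemma cis_0 : cis 0 = 1%C.
Proof. unfold cis. now rewrite cos_0, sin_0. Qed.

Lemma cis_opp_l (x : R) : (cis (- x) * cis x)%C = 1%C.
Proof. rewrite <- cis_add, Rplus_opp_l. apply cis_0. Qed.

Lemma Cmod_cis (x : R) : Cmod (cis x) = 1.
Proof.
  unfold cis, Cmod; cbn. rewrite !Rmult_1_r.
  pose proof (sin2_cos2 x) as H. unfold Rsqr in H.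
  replace (cos x * cos x + sin x * sin x) with 1 by lra. apply sqrt_1.
Qed.

Lemma Cmod_le (z : C) (m : R) : 0 <= m -> fst z * fst z + snd z * snd z <= m * m -> Cmod z <= m.
Proof.
  intros Hm H. unfold Cmod. rewrite <- (sqrt_square m) by exact Hm.
  apply sqrt_le_1_alt. cbn. lra.
Qed.

Definition gamma_mix (th : R) (a b : C) : C := ((cis th * a + cis (- th) * b) / 2)%C.

(** If n ends in exactly k ones, which has density 2^(-k-1), then s(n+1) - s(n) = 1 - k; the second
    component is the sum of the resulting geometric series. *)
Definition gamma_init (th : R) : C * C := (RtoC 1, (cis th / (2 - cis (- th)))%C).

(* [fst (gamma th l)] is the characteristic function at [th] of the limiting
   distribution of s(n+t) - s(n), where t = [value l]; [snd (gamma th l)] is that of t+1. *)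
Definition gamma (th : R) (l : list bool) : C * C := digit_fold (gamma_mix th) (gamma_init th) l.

Lemma cis_denom_neq_0 (th : R) : (2 - cis (- th))%C <> 0%C.
Proof.
  intros H. apply (f_equal fst) in H. cbn in H. pose proof (COS_bound (- th)). lra.
Qed.

Lemma RtoC_neq_0 (x : R) : x <> 0 -> RtoC x <> 0%C.
Proof. intros H E. now apply RtoC_inj in E. Qed.

Lemma C2_neq_0 : RtoC 2 <> 0%C.
Proof. apply RtoC_neq_0. lra. Qed.

Lemma gamma_init_fixed (th : R) :
  gamma_mix th (fst (gamma_init th)) (snd (gamma_init th)) = snd (gamma_init th).
Proof.
  unfold gamma_mix, gamma_init; cbn [fst snd].
  pose proof (cis_denom_neq_0 th). pose proof C2_neq_0.
  field. repeat split; try assumption.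
Qed.

Lemma gamma_mix_le (th M N : R) (a b : C) :
  Cmod a <= M -> Cmod b <= N -> Cmod (gamma_mix th a b) <= (M + N) / 2.
Proof.
  intros Ha Hb. unfold gamma_mix, Cdiv.
  rewrite Cmod_mult, Cmod_inv by apply C2_neq_0.
  rewrite (Cmod_R 2), Rabs_right by lra.
  apply Rmult_le_compat_r; [lra|].
  apply Rle_trans with (1 := Cmod_triangle _ _).
  rewrite !Cmod_mult, !Cmod_cis. lra.
Qed.

Definition bounded_by (M : R) (s : C * C) : Prop := Cmod (fst s) <= M /\ Cmod (snd s) <= M.

Lemma bounded_by_step (th M : R) (d : bool) (s : C * C) :
  bounded_by M s -> bounded_by M (digit_step (gamma_mix th) d s).
Proof.
  intros [Ha Hb]. pose proof (gamma_mix_le th M M _ _ Ha Hb).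
  destruct d; split; cbn; lra.
Qed.

Lemma gamma_init_bounded (th : R) : bounded_by 1 (gamma_init th).
Proof.
  split; cbn [gamma_init fst snd]; [rewrite Cmod_1; lra|].
  pose proof (gamma_mix_le th 1 (Cmod (snd (gamma_init th))) (fst (gamma_init th))
    (snd (gamma_init th))) as H.
  rewrite gamma_init_fixed in H. cbn [gamma_init fst snd] in H.
  rewrite Cmod_1 in H. lra.
Qed.

Lemma half_cis_plus_quarter (th : R) :
  Cmod (cis th / 2 + 1 / 4)%C <= 3 / 4 - (1 - cos th) / 6.
Proof.
  pose proof (COS_bound th). apply Cmod_le; [lra|].
  replace (cis th / 2 + 1 / 4)%C with ((cos th / 2 + 1 / 4, sin th / 2) : C).
  2:{ unfold cis, Cdiv, Cmult, Cplus, Cinv; cbn. f_equal; field. }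
  cbn. pose proof (sin2_cos2 th) as H1. unfold Rsqr in H1. nra.
Qed.

(** After two digits, one of the two old values has been reached along two paths, with coefficients
    [cis th / 2] (or its conjugate) and 1/4. Their phases differ, so the modulus of the sum falls
    short of 3/4, and this gives the decay. *)
Lemma contraction_one (th M : R) (d : bool) (s : C * C) :
  bounded_by M s ->
  Cmod (fst (digit_step (gamma_mix th) true (digit_step (gamma_mix th) d s)))
    <= (1 - (1 - cos th) / 6) * M.
Proof.
  intros [Ha Hb]. destruct s as [a b]. cbn [fst snd] in *.
  assert (HM : 0 <= M) by (pose proof (Cmod_ge_0 a); lra).
  assert (H4 : forall z : C, Cmod z <= 1 -> forall c, Cmod c <= M -> Cmod (z / 4 * c) <= M / 4).
  { intros z Hz c Hc. unfold Cdiv. rewrite !Cmod_mult, Cmod_inv by (apply RtoC_neq_0; lra).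
    rewrite (Cmod_R 4), Rabs_right by lra.
    pose proof (Cmod_ge_0 z). pose proof (Cmod_ge_0 c). nra. }
  assert (Hsq : forall x, Cmod (cis x * cis x) <= 1) by (intros; rewrite Cmod_mult, Cmod_cis; lra).
  pose proof (cis_opp_l th) as He.
  destruct d; cbn [digit_step fst snd].
  - replace (gamma_mix th (gamma_mix th a b) b) with
      (cis th * cis th / 4 * a + (cis (- th) / 2 + 1 / 4) * b)%C.
    2:{ unfold gamma_mix. replace (RtoC 1 / RtoC 4)%C with (cis (- th) * cis th / 4)%C by now rewrite He.
        field. }
    apply Rle_trans with (1 := Cmod_triangle _ _).
    pose proof (H4 _ (Hsq th) a Ha). rewrite (Cmod_mult (_ + _)%C).
    pose proof (half_cis_plus_quarter (- th)) as Hq. rewrite cos_neg in Hq.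
    pose proof (Cmod_ge_0 (cis (- th) / 2 + 1 / 4)%C). pose proof (Cmod_ge_0 b). nra.
  - replace (gamma_mix th a (gamma_mix th a b)) with
      ((cis th / 2 + 1 / 4) * a + cis (- th) * cis (- th) / 4 * b)%C.
    2:{ unfold gamma_mix. replace (RtoC 1 / RtoC 4)%C with (cis (- th) * cis th / 4)%C by now rewrite He.
        field. }
    apply Rle_trans with (1 := Cmod_triangle _ _).
    pose proof (H4 _ (Hsq (- th)) b Hb). rewrite (Cmod_mult (_ + _)%C).
    pose proof (half_cis_plus_quarter th) as Hq.
    pose proof (Cmod_ge_0 (cis th / 2 + 1 / 4)%C). pose proof (Cmod_ge_0 a). nra.
Qed.

(** The digit 0 averages the contracted component with the other one. The gain drops from 1/6 to
    1/12, but now both components have it. *)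
Lemma contraction_one_zero (th M : R) (d : bool) (s : C * C) :
  bounded_by M s ->
  bounded_by ((1 - (1 - cos th) / 12) * M)
    (digit_step (gamma_mix th) false (digit_step (gamma_mix th) true
      (digit_step (gamma_mix th) d s))).
Proof.
  intros Hs. pose proof (contraction_one th M d s Hs) as H1.
  pose proof (bounded_by_step th M true _ (bounded_by_step th M d s Hs)) as [_ H2].
  set (u := digit_step (gamma_mix th) true (digit_step (gamma_mix th) d s)) in *.
  assert (HM : 0 <= M) by (pose proof (Cmod_ge_0 (snd u)); lra).
  pose proof (COS_bound th).
  pose proof (gamma_mix_le th _ _ _ _ H1 H2).
  assert (0 <= (1 - cos th) * M) by (apply Rmult_le_pos; lra).
  split; cbn [digit_step fst snd]; lra.
Qed.

(** Half of the gain 1/12. The three digits consumed by one contraction can account for two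
    descents, because the top digit of the window may be the 0 of the next one; so each contraction
    has to provide the factor [rho th] twice. *)
Definition rho (th : R) : R := 1 - (1 - cos th) / 24.

Lemma gamma_bound (th : R) (l : list bool) : bounded_by (rho th ^ descents l) (gamma th l).
Proof.
  assert (Hr : 0 < rho th <= 1) by (unfold rho; pose proof (COS_bound th); lra).
  assert (Hweak : forall m n s, (m <= n)%nat -> bounded_by (rho th ^ n) s -> bounded_by (rho th ^ m) s).
  { intros m n s Hmn [H1 H2].
    assert (rho th ^ n <= rho th ^ m).
    { replace n with (m + (n - m))%nat by lia. rewrite pow_add.
      assert (0 < rho th ^ m) by (apply pow_lt; lra).
      assert (rho th ^ (n - m) <= 1) by (rewrite <- (pow1 (n - m)); apply pow_incr; lra).
      nra. }
    split; lra. }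
  assert (Hcontr : forall n d s, bounded_by (rho th ^ n) s ->
    bounded_by (rho th ^ S (S n)) (digit_step (gamma_mix th) false
      (digit_step (gamma_mix th) true (digit_step (gamma_mix th) d s)))).
  { intros n d s Hs. destruct (contraction_one_zero th _ d s Hs) as [H1 H2].
    assert ((1 - (1 - cos th) / 12) * rho th ^ n <= rho th ^ S (S n)).
    { cbn [pow]. rewrite <- Rmult_assoc. apply Rmult_le_compat_r; [apply pow_le; lra|].
      unfold rho. pose proof (Rle_0_sqr (1 - cos th)) as Hq. unfold Rsqr in Hq. lra. }
    split; lra. }
  assert (Hfix : digit_step (gamma_mix th) false (gamma_init th) = gamma_init th).
  { cbn. rewrite gamma_init_fixed. reflexivity. }
  (* A contraction reaches back over three digits, so the bound is carried along for two tails as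
     well. *)
  enough (H : bounded_by (rho th ^ descents l) (gamma th l) /\
    bounded_by (rho th ^ descents (tl l)) (gamma th (tl l)) /\
    bounded_by (rho th ^ descents (tl (tl l))) (gamma th (tl (tl l)))) by apply H.
  induction l as [|d l IH].
  { cbn. pose proof (gamma_init_bounded th). auto. }
  split; [|exact (conj (proj1 IH) (proj1 (proj2 IH)))].
  change (gamma th (d :: l)) with (digit_step (gamma_mix th) d (gamma th l)).
  destruct (negb d && head_digit l) eqn:Hd.
  2:{ apply Hweak with (descents l); [cbn; rewrite Hd; cbn; lia|].
      apply bounded_by_step, IH. }
  apply andb_prop in Hd. destruct Hd as [Hd Hh].
  destruct d; [discriminate|]. destruct l as [|d' l]; [discriminate|].
  cbn [head_digit] in Hh. subst d'.
  destruct IH as (_ & _ & IH). cbn [tl] in IH.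
  change (gamma th (true :: l)) with (digit_step (gamma_mix th) true (gamma th l)).
  destruct l as [|d l].
  (* There is no third digit here; a leading 0, which leaves the initial state fixed, completes the
     window. *)
  - change (gamma th nil) with (gamma_init th). rewrite <- Hfix.
    apply Hweak with 2%nat; [cbn; lia|].
    apply Hcontr. apply gamma_init_bounded.
  - change (gamma th (d :: l)) with (digit_step (gamma_mix th) d (gamma th l)).
    apply Hweak with (S (S (descents l))).
    + cbn. destruct d, (head_digit l); cbn; lia.
    + apply Hcontr, IH.
Qed.

(** * Second and third cumulants *)

(** With mean 0 throughout, mixing A + 1 and B - 1 with equal weights gives v = (va + vb) / 2 + 1
    and kappa_3 = (ka + kb) / 2 + 3 (va - vb) / 2. These formulas are rewritten here for v / 2 and 3
    v - kappa_3. *)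
Definition cum_mix (p q : R * R) : R * R :=
  ((fst p + fst q) / 2 + 1 / 2, (snd p + snd q) / 2 + 3 + 3 * (fst q - fst p)).

(* [fst] is half the variance and [snd] is three times the variance minus the third cumulant. *)
Definition cum (l : list bool) : (R * R) * (R * R) := digit_fold cum_mix ((0, 0), (1, 12)) l.

Lemma cum_cons (d : bool) (l : list bool) : cum (d :: l) = digit_step cum_mix d (cum l).
Proof. reflexivity. Qed.

(** A digit sends the difference D to (D - 1) / 2 or (D + 1) / 2. The bound makes the increment 3 +
    3 D of the second component nonnegative. *)
Lemma cum_nu_dist (l : list bool) :
  let s := cum l in
  -1 <= fst (snd s) - fst (fst s) <= 1.
Proof.
  induction l as [|d l IH]; [cbn; lra|].
  rewrite cum_cons. destruct (cum l) as [[na Wa] [nb Wb]]. destruct d; cbn in *; lra.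
Qed.

Lemma cum_nu_lower (l : list bool) :
  let s := cum l in
  INR (descents l) / 2 + (if head_digit l then 1 / 2 else 0) <= fst (fst s) /\
  INR (descents l) / 2 <= fst (snd s).
Proof.
  induction l as [|d l IH]; [cbn; lra|].
  cbv zeta in *. rewrite cum_cons. destruct (cum l) as [[na Wa] [nb Wb]].
  cbn [descents]. rewrite plus_INR. cbn in IH.
  destruct d, (head_digit l) eqn:E; cbn in *; lra.
Qed.

Lemma cum_nu_upper (l : list bool) : fst (fst (cum l)) <= 2 * INR (descents l) + 2.
Proof.
  (* In a run of 1s the second component stands still, in a run of 0s the first. Following the one
     at rest, the bound grows only where the digit changes, by at most 1 each time. *)
  enough (H : if head_digit l then fst (snd (cum l)) <= 2 * INR (descents l) + 1
    else fst (fst (cum l)) <= 2 * INR (descents l)).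
  { pose proof (cum_nu_dist l). cbv zeta in *. destruct (head_digit l); lra. }
  induction l as [|d l IH]; [cbn; lra|].
  pose proof (cum_nu_dist l) as HD. rewrite cum_cons.
  cbv zeta in *. destruct (cum l) as [[na Wa] [nb Wb]].
  cbn [descents]. rewrite plus_INR.
  destruct d, (head_digit l) eqn:E; cbn in *; lra.
Qed.

(** Mixing adds 3 + 3 D, between 0 and 6, to the second component and 1/2 to the first, which
    preserves W <= 12 nu. The state stays the initial one while only zeros are read, and the first
    digit 1 brings both second components to 12. *)
Lemma cum_W_range (l : list bool) :
  let s := cum l in
  (0 <= snd (fst s) <= 12 * fst (fst s)) /\ (12 <= snd (snd s) <= 12 * fst (snd s)) /\
  (s = ((0, 0), (1, 12)) \/ 12 <= snd (fst s)).
Proof.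
  induction l as [|d l IH]; [cbn; repeat split; try lra; now left|].
  pose proof (cum_nu_dist l) as HD. rewrite cum_cons.
  cbv zeta in *. destruct (cum l) as [[na Wa] [nb Wb]].
  destruct IH as (H1 & H2 & H3). cbn in *.
  destruct d; cbn; destruct H3 as [H3|H3];
    try (injection H3 as -> -> -> ->); repeat split; try lra; try (right; lra).
  left. apply (f_equal (pair (0, 0))). unfold cum_mix; cbn. apply (f_equal2 pair); lra.
Qed.

(* Along a block of 1s the two third cumulants get close to each other at the same
   geometric rate as the variances, up to a linear factor in the length of the block:
   the parameter [m] trades that factor against an additive error. *)
Lemma cum_W_dist (l : list bool) :
  let s := cum l in
  Rabs (snd (fst s) - snd (snd s)) <= 12 /\
  forall m : nat, Rabs (snd (fst s) - snd (snd s))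
    <= (12 + 6 * INR m) * (1 + (fst (snd s) - fst (fst s))) + 12 / 2 ^ m.
Proof.
  induction l as [|d l IH].
  { cbn. rewrite Rminus_0_l, Rabs_Ropp, Rabs_right by lra. split; [lra|].
    intros m. pose proof (pos_INR m).
    assert (0 < 12 / 2 ^ m) by (apply Rdiv_lt_0_compat; [lra|apply pow_lt; lra]). lra. }
  pose proof (cum_nu_dist l) as HD. rewrite cum_cons.
  cbv zeta in *. destruct (cum l) as [[na Wa] [nb Wb]].
  destruct IH as (H1 & H2). cbn [fst snd] in *.
  pose proof (proj1 (Rabs_le_between _ _) H1) as H1'.
  destruct d; cbn [digit_step cum_mix fst snd].
  - replace ((Wa + Wb) / 2 + 3 + 3 * (nb - na) - Wb) with
      ((Wa - Wb) / 2 + 3 * (1 + (nb - na))) by field.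
    split; [apply Rabs_le; lra|].
    intros [|m].
    + cbn. apply Rabs_le. lra.
    + specialize (H2 m). apply Rabs_le_between in H2. rewrite S_INR. cbn [pow].
      replace (12 / (2 * 2 ^ m)) with (12 / 2 ^ m / 2) by (field; apply pow_nonzero; lra).
      apply Rabs_le. lra.
  - replace (Wa - ((Wa + Wb) / 2 + 3 + 3 * (nb - na))) with
      ((Wa - Wb) / 2 - 3 * (1 + (nb - na))) by field.
    split; [apply Rabs_le; lra|].
    intros m. pose proof (pos_INR m).
    assert (0 < 12 / 2 ^ m) by (apply Rdiv_lt_0_compat; [lra|apply pow_lt; lra]).
    apply Rle_trans with 12; [apply Rabs_le; lra|]. nra.
Qed.

(** * Real powers of the reference function *)

Definition denom (th : R) : R := 5 - 4 * cos th.

Definition mu (th : R) : R := ln (denom th) / 2.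

(** The argument of r. Since 2 - cos th > 0, [atan] provides a smooth branch for all th, so that
    real powers of r make sense. *)
Definition phi (th : R) : R := atan (sin th / (2 - cos th)) - th.

(* The real power r^x of r = e^(-i th) / (2 - e^(i th)) = exp (- mu + i phi), the
   characteristic function of G - 1 for a geometric variable G of parameter 1/2. *)
Definition rpow (x th : R) : C := (exp (- (x * mu th)) * cis (x * phi th))%C.

Lemma denom_range (th : R) : 1 <= denom th <= 9.
Proof. unfold denom. pose proof (COS_bound th). lra. Qed.

Lemma rpow_add (x y th : R) : rpow (x + y) th = (rpow x th * rpow y th)%C.
Proof.
  unfold rpow. replace (- ((x + y) * mu th)) with (- (x * mu th) + - (y * mu th)) by ring.
  rewrite Rmult_plus_distr_r, cis_add, exp_plus, RtoC_mult. ring.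
Qed.

Lemma rpow_0 (th : R) : rpow 0 th = RtoC 1.
Proof. unfold rpow. rewrite !Rmult_0_l, Ropp_0, exp_0, cis_0. ring. Qed.

Lemma mu_nonneg (th : R) : 0 <= mu th.
Proof.
  unfold mu. pose proof (denom_range th).
  assert (0 <= ln (denom th)) by (rewrite <- ln_1; apply ln_le; lra). lra.
Qed.

Lemma Cmod_rpow (x th : R) : Cmod (rpow x th) = exp (- (x * mu th)).
Proof.
  unfold rpow. rewrite Cmod_mult, Cmod_cis, Cmod_R, Rabs_right, Rmult_1_r; [reflexivity|].
  apply Rle_ge, Rlt_le, exp_pos.
Qed.

Lemma Cmod_rpow_le_1 (x th : R) : 0 <= x -> Cmod (rpow x th) <= 1.
Proof.
  intros Hx. rewrite Cmod_rpow, <- exp_0. pose proof (mu_nonneg th).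
  destruct (Rle_lt_or_eq_dec 0 (x * mu th)) as [H'|H']; [nra| |].
  - left. apply exp_increasing. lra.
  - rewrite <- H'. right. f_equal. ring.
Qed.

Lemma exp_opp_mu (th : R) : exp (- mu th) = / sqrt (denom th).
Proof.
  pose proof (denom_range th). rewrite exp_Ropp. f_equal.
  rewrite <- (sqrt_square (exp (mu th))) by apply Rlt_le, exp_pos.
  f_equal. rewrite <- exp_plus. unfold mu.
  replace (ln (denom th) / 2 + ln (denom th) / 2) with (ln (denom th)) by field.
  apply exp_ln. lra.
Qed.

Lemma rpow_1 (th : R) : fst (rpow 1 th) = (2 * cos th - cos (2 * th)) / denom th /\
  snd (rpow 1 th) = (sin (2 * th) - 2 * sin th) / denom th.
Proof.
  pose proof (denom_range th) as Hd. pose proof (COS_bound th) as Hc.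
  pose proof (sin2_cos2 th) as Hsc. unfold Rsqr in Hsc.
  assert (Hs : sqrt (1 + Rsqr (sin th / (2 - cos th))) = sqrt (denom th) / (2 - cos th)).
  { rewrite <- (sqrt_square (2 - cos th)) at 2 by lra.
    rewrite <- sqrt_div_alt by nra. f_equal. unfold Rsqr, denom. field_simplify; [|lra|lra].
    f_equal. nra. }
  assert (Hq : 0 < sqrt (denom th)) by (apply sqrt_lt_R0; lra).
  assert (Hqq : sqrt (denom th) * sqrt (denom th) = denom th) by (apply sqrt_sqrt; lra).
  unfold rpow, cis. cbn [fst snd Cmult RtoC]. rewrite !Rmult_1_l, exp_opp_mu.
  change (phi th) with (atan (sin th / (2 - cos th)) + - th).
  rewrite cos_plus, sin_plus, cos_atan, sin_atan, cos_neg, sin_neg, Hs, cos_2a, sin_2a.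
  remember (sqrt (denom th)) as q. rewrite <- Hqq. split; field; lra.
Qed.

(** This amounts to (cis th r + cis (- th)) / 2 = r: a digit 1 leaves a pair (r b, b) fixed. A long
    block of 1s drives the state towards such a pair, where powers of r reproduce the recursion
    without error. *)
Lemma cis_rpow_opp_1 (th : R) : (cis (- th) * rpow (-1) th = 2 - cis th)%C.
Proof.
  assert (H1 : (rpow (-1) th * rpow 1 th = 1)%C).
  { rewrite <- rpow_add. replace (-1 + 1) with 0 by ring. apply rpow_0. }
  assert (H2 : (rpow 1 th * (2 - cis th) = cis (- th))%C).
  { destruct (rpow_1 th) as [Ha Hb]. destruct (rpow 1 th) as [a b]. cbn [fst snd] in *. subst.
    unfold cis, Cmult, Cminus, Cplus, Copp, RtoC; cbn [fst snd].
    pose proof (denom_range th). rewrite cos_neg, sin_neg, cos_2a, sin_2a.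
    pose proof (sin2_cos2 th) as Hsc. unfold Rsqr in Hsc.
    replace (sin th * sin th) with (1 - cos th * cos th) by lra.
    apply (f_equal2 pair).
    - replace (((2 * cos th - (cos th * cos th - (1 - cos th * cos th))) / denom th) * (2 + - cos th) -
        (2 * sin th * cos th - 2 * sin th) / denom th * (0 + - sin th)) with
        (((2 * cos th - (cos th * cos th - (1 - cos th * cos th))) * (2 - cos th) +
        (2 * cos th - 2) * (sin th * sin th)) / denom th) by (field; lra).
      replace (sin th * sin th) with (1 - cos th * cos th) by lra.
      unfold denom in *. field. lra.
    - unfold denom in *. field. lra. }
  rewrite <- H2.
  transitivity (rpow (-1) th * rpow 1 th * (2 - cis th))%C; [ring|]. rewrite H1. ring.
Qed.

Lemma is_derive_phi (th : R) : is_derive phi th (- (6 * (1 - cos th) / denom th)).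
Proof.
  pose proof (denom_range th). pose proof (COS_bound th).
  pose proof (sin2_cos2 th) as Hsc. unfold Rsqr in Hsc.
  unfold phi. auto_derive; [lra|].
  assert (Hd : (2 - cos th) * (2 - cos th) + sin th * sin th = denom th) by (unfold denom; nra).
  match goal with |- ?x = _ => replace x with
    ((cos th * (2 - cos th) - sin th * sin th) / ((2 - cos th) * (2 - cos th) + sin th * sin th) - 1)
  end.
  2:{ field. split; [lra|nra]. }
  rewrite Hd. replace (sin th * sin th) with (1 - cos th * cos th) by lra.
  unfold denom in *. field. lra.
Qed.

Lemma is_derive_mu (th : R) : is_derive mu th (2 * sin th / denom th).
Proof.
  pose proof (denom_range th). unfold denom in *. unfold mu, denom.
  auto_derive; [lra|field; lra].
Qed.

(** * Expansions near 0 *)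

Lemma one_minus_cos_le (x : R) : 1 - cos x <= x * x / 2.
Proof.
  enough (H : forall y, 0 <= y -> 1 - cos y <= y * y / 2).
  { destruct (Rle_dec 0 x) as [Hx|Hx]; [now apply H|].
    rewrite <- cos_neg. replace (x * x) with (- x * - x) by ring. apply H. lra. }
  intros y Hy. destruct (Rle_dec y 2) as [H2|H2].
  - pose proof (pre_cos_bound y 0) as Hb. unfold cos_approx, cos_term in Hb. cbn in Hb. lra.
  - pose proof (COS_bound y). nra.
Qed.

Lemma one_minus_cos_ge (x : R) : 0 <= x <= 1 -> x * x / 2 - x * x * x * x / 24 <= 1 - cos x.
Proof.
  intros Hx. pose proof (pre_cos_bound x 0) as Hb. unfold cos_approx, cos_term in Hb.
  cbn in Hb. lra.
Qed.

Lemma sin_le_id (x : R) : 0 <= x -> sin x <= x.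
Proof.
  intros [Hx|<-]; [left; now apply sin_lt_x|rewrite sin_0; lra].
Qed.

Lemma sin_ge_cubic (x : R) : 0 <= x <= 4 -> x - x * x * x / 6 <= sin x.
Proof.
  intros Hx. pose proof (pre_sin_bound x 0) as Hb. unfold sin_approx, sin_term in Hb.
  cbn in Hb. lra.
Qed.

Lemma sin_dist_id (x : R) : Rabs x <= 3 -> Rabs (sin x - x) <= x * x.
Proof.
  enough (H : forall y, 0 <= y <= 3 -> Rabs (sin y - y) <= y * y).
  { intros Hx. apply Rabs_le_between in Hx. destruct (Rle_dec 0 x).
    - apply H. lra.
    - replace (sin x - x) with (- (sin (- x) - - x)) by (rewrite sin_neg; ring).
      rewrite Rabs_Ropp. replace (x * x) with (- x * - x) by ring. apply H. lra. }
  intros y Hy. pose proof (sin_le_id y). pose proof (sin_ge_cubic y). apply Rabs_le. nra.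
Qed.

Lemma Cmod_le_abs (a b : R) : Cmod (a, b) <= Rabs a + Rabs b.
Proof.
  pose proof (Rabs_pos a). pose proof (Rabs_pos b).
  apply Cmod_le; [lra|]. cbn.
  assert (Hs : forall x, Rabs x * Rabs x = x * x).
  { intros x. rewrite <- Rabs_mult. apply Rabs_right, Rle_ge. nra. }
  pose proof (Hs a). pose proof (Hs b). nra.
Qed.

Lemma mu_bounds (th : R) : 0 <= th <= 1 ->
  th * th - 3 * th * th * th * th <= mu th <= th * th.
Proof.
  intros Hth. unfold mu. pose proof (denom_range th).
  assert (H1 : ln (denom th) <= denom th - 1).
  { rewrite <- (ln_exp (denom th - 1)). apply ln_le; [lra|].
    pose proof (exp_ineq1_le (denom th - 1)). lra. }
  assert (H2 : 1 - / denom th <= ln (denom th)).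
  { assert (E : ln (denom th) = - ln (/ denom th)) by (rewrite ln_Rinv; lra).
    rewrite E. assert (Hi : 0 < / denom th) by (apply Rinv_0_lt_compat; lra).
    enough (ln (/ denom th) <= / denom th - 1) by lra.
    rewrite <- (ln_exp (/ denom th - 1)). apply ln_le; [lra|].
    pose proof (exp_ineq1_le (/ denom th - 1)). lra. }
  pose proof (one_minus_cos_le th). pose proof (one_minus_cos_ge th Hth).
  assert (Hx : 1 - / denom th >= (denom th - 1) - (denom th - 1) * (denom th - 1)).
  { assert (E : 1 - / denom th = (denom th - 1) - (denom th - 1) * (denom th - 1) * / denom th)
      by (field; lra).
    rewrite E. assert (Hi : / denom th <= 1) by (rewrite <- Rinv_1; apply Rinv_le_contravar; lra).
    pose proof (Rle_0_sqr (denom th - 1)) as Hq. unfold Rsqr in Hq.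
    apply Rle_ge, Rplus_le_compat_l, Ropp_le_contravar.
    rewrite <- (Rmult_1_r ((denom th - 1) * (denom th - 1))) at 2.
    apply Rmult_le_compat_l; lra. }
  unfold denom in *. set (t4 := th * th * th * th) in *.
  assert (Hsq : (1 - cos th) * (1 - cos th) <= t4 / 4).
  { unfold t4. pose proof (COS_bound th).
    replace (th * th * th * th / 4) with (th * th / 2 * (th * th / 2)) by field.
    apply Rmult_le_compat; lra. }
  replace (3 * th * th * th * th) with (3 * t4) by (unfold t4; ring).
  split; nra.
Qed.

Lemma phi_0 : phi 0 = 0.
Proof. unfold phi. rewrite sin_0, Rdiv_0_l, atan_0. ring. Qed.

Lemma phi_bound (th : R) : 0 <= th -> Rabs (phi th) <= 3 * th * th * th.
Proof.
  intros Hth.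
  destruct (MVT_gen phi 0 th (fun x => - (6 * (1 - cos x) / denom x))) as (c & Hc & E).
  - intros x _. apply is_derive_phi.
  - intros x _. apply continuity_pt_filterlim.
    apply (ex_derive_continuous phi). eexists. apply is_derive_phi.
  - rewrite phi_0, !Rminus_0_r in E. rewrite E, Rmin_left, Rmax_right in * by lra.
    pose proof (one_minus_cos_le c). pose proof (denom_range c). pose proof (COS_bound c).
    rewrite Rabs_mult, Rabs_Ropp, (Rabs_right th) by lra.
    apply Rmult_le_compat_r; [lra|].
    assert (Hi : 0 < / denom c <= 1)
      by (split; [apply Rinv_0_lt_compat; lra|rewrite <- Rinv_1; apply Rinv_le_contravar; lra]).
    unfold Rdiv. rewrite Rabs_right by nra. nra.
Qed.

(** * The defect of the approximation *)

(** The logarithm of r, which is - th^2 + O(th^3). *)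
Definition lam (th : R) : C := (- mu th, phi th).

Lemma exp_opp_taylor (a : R) : Rabs a <= 1 -> Rabs (exp (- a) - 1 + a) <= 2 * (a * a).
Proof.
  intros Ha. apply Rabs_le_between in Ha.
  pose proof (exp_ineq1_le (- a)) as H1.
  pose proof (exp_ineq1_le (a / 2)) as H2.
  assert (H3 : exp (- a) = / (exp (a / 2) * exp (a / 2))).
  { rewrite exp_Ropp. f_equal. rewrite <- exp_plus. f_equal. field. }
  assert (H4 : exp (- a) <= / ((1 + a / 2) * (1 + a / 2))).
  { rewrite H3. apply Rinv_le_contravar; nra. }
  assert (H5 : / ((1 + a / 2) * (1 + a / 2)) <= 1 - a + 2 * (a * a)).
  { assert (Hp : 0 < (1 + a / 2) * (1 + a / 2)) by nra.
    apply Rmult_le_reg_l with (1 := Hp). rewrite Rinv_r by lra. 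
    assert (0 <= (a * a) * ((1 + a) * (5 / 2 + a))) by (apply Rmult_le_pos; nra). lra. }
  apply Rabs_le. nra.
Qed.

Lemma Rabs_sin_le (b : R) : Rabs (sin b) <= Rabs b.
Proof.
  pose proof PI2_3_2 as Hpi. unfold PI2 in Hpi. pose proof (SIN_bound b).
  destruct (Rle_dec 0 b).
  - pose proof (sin_le_id b). rewrite (Rabs_right b) by lra. apply Rabs_le.
    split; [|lra]. destruct (Rle_dec b PI); [pose proof (sin_ge_0 b)|]; lra.
  - pose proof (sin_le_id (- b)). rewrite (Rabs_left b) by lra. rewrite sin_neg in *.
    apply Rabs_le. split; [lra|].
    destruct (Rle_dec (- b) PI); [pose proof (sin_ge_0 (- b))|]; rewrite ?sin_neg in *; lra.
Qed.

(** The factor [Rabs s] in the error is essential: it is applied with s = y and s = - y, and the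
    defect must vanish together with y. *)
Lemma rpow_taylor (s th : R) : Rabs s <= 1 -> 0 <= th <= 1 ->
  Cmod (rpow s th - 1 - s * lam th) <= 60 * Rabs s * (th * th * th * th).
Proof.
  intros Hs Hth. pose proof (mu_bounds th Hth) as Hmu. pose proof (mu_nonneg th) as Hmu0.
  pose proof (phi_bound th ltac:(lra)) as Hphi.
  pose proof (Rabs_pos s) as Hs0.
  replace (th * th * th * th) with (th * th * (th * th)) by ring.
  set (t2 := th * th) in *. assert (Ht2 : 0 <= t2 <= 1) by (unfold t2; nra).
  set (a := s * mu th). set (b := s * phi th).
  assert (Ha : Rabs a <= Rabs s * t2).
  { unfold a. rewrite Rabs_mult, (Rabs_right (mu th)) by lra. nra. }
  assert (Hb : Rabs b <= 3 * (Rabs s * t2)).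
  { unfold b. rewrite Rabs_mult.
    assert (Rabs (phi th) <= 3 * t2) by (apply Rle_trans with (1 := Hphi); unfold t2 in *; nra).
    nra. }
  assert (Hst : 0 <= Rabs s * t2 <= Rabs s).
  { split; [apply Rmult_le_pos; lra|]. rewrite <- (Rmult_1_r (Rabs s)) at 2.
    apply Rmult_le_compat_l; lra. }
  assert (Hq : (Rabs s * t2) * (Rabs s * t2) <= Rabs s * (t2 * t2)).
  { replace ((Rabs s * t2) * (Rabs s * t2)) with (Rabs s * (Rabs s * (t2 * t2))) by ring.
    apply Rmult_le_compat_l; [lra|]. rewrite <- (Rmult_1_l (t2 * t2)) at 2.
    apply Rmult_le_compat_r; [apply Rmult_le_pos|]; lra. }
  assert (Hq0 : 0 <= Rabs s * (t2 * t2)) by (repeat apply Rmult_le_pos; lra).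
  assert (Hsq : forall x, Rabs x * Rabs x = x * x).
  { intros x. rewrite <- Rabs_mult. apply Rabs_right, Rle_ge. nra. }
  assert (Haa : a * a <= Rabs s * (t2 * t2)).
  { match goal with |- ?x * _ <= _ => rewrite <- (Hsq x) end. apply Rle_trans with (2 := Hq). apply Rmult_le_compat; try apply Rabs_pos; lra. }
  assert (Hbb : b * b <= 9 * (Rabs s * (t2 * t2))).
  { match goal with |- ?x * _ <= _ => rewrite <- (Hsq x) end. apply Rle_trans with (3 * (Rabs s * t2) * (3 * (Rabs s * t2))); [|nra].
    apply Rmult_le_compat; try apply Rabs_pos; lra. }
  assert (Hab : Rabs a * Rabs b <= 3 * (Rabs s * (t2 * t2))).
  { apply Rle_trans with (Rabs s * t2 * (3 * (Rabs s * t2))); [|nra].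
    apply Rmult_le_compat; try apply Rabs_pos; lra. }
  pose proof (exp_opp_taylor a ltac:(lra)) as He.
  pose proof (sin_dist_id b ltac:(lra)) as Hsin.
  pose proof (one_minus_cos_le b) as Hcos. pose proof (COS_bound b). pose proof (SIN_bound b).
  replace (rpow s th - 1 - s * lam th)%C with
    ((exp (- a) - 1 + a + exp (- a) * (cos b - 1),
      (exp (- a) - 1) * sin b + (sin b - b)) : C).
  2:{ unfold rpow, cis, lam, Cmult, Cminus, Cplus, Copp, RtoC; cbn [fst snd].
      fold a b. apply (f_equal2 pair); unfold a, b; ring. }
  assert (He0 := exp_pos (- a)).
  assert (Hexp : Rabs (exp (- a) - 1) <= 3 * Rabs a).
  { replace (exp (- a) - 1) with ((exp (- a) - 1 + a) + - a) by ring.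
    apply Rle_trans with (1 := Rabs_triang _ _). rewrite Rabs_Ropp.
    rewrite <- (Hsq a) in He. pose proof (Rabs_pos a).
    assert (Rabs a * Rabs a <= Rabs a * 1) by (apply Rmult_le_compat_l; lra). lra. }
  apply Rle_trans with (1 := Cmod_le_abs _ _).
  apply Rle_trans with (2 * (Rabs s * (t2 * t2)) + 18 * (Rabs s * (t2 * t2)) +
    (3 * (3 * (Rabs s * (t2 * t2))) + 9 * (Rabs s * (t2 * t2)))).
  2:{ lra. }
  apply Rplus_le_compat.
  - apply Rle_trans with (1 := Rabs_triang _ _). apply Rplus_le_compat; [lra|].
    assert (Hem : exp (- a) <= 4).
    { apply Rabs_le_between in Hexp. lra. }
    rewrite Rabs_mult, (Rabs_right (exp _)) by lra.
    rewrite Rabs_left1 by lra. nra.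
  - apply Rle_trans with (1 := Rabs_triang _ _). apply Rplus_le_compat; [|lra].
    rewrite Rabs_mult.
    pose proof (Rabs_sin_le b).
    apply Rle_trans with (3 * Rabs a * Rabs b); [|nra].
    apply Rmult_le_compat; try apply Rabs_pos; lra.
Qed.

Lemma lam_near (th : R) : 0 <= th <= 1 -> Cmod (lam th + RtoC (th * th))%C <= 6 * (th * th * th).
Proof.
  intros Hth. pose proof (mu_bounds th Hth) as Hmu. pose proof (phi_bound th ltac:(lra)) as Hphi.
  replace (lam th + RtoC (th * th))%C with ((th * th - mu th, phi th) : C).
  2:{ unfold lam, Cplus, RtoC; cbn [fst snd]. apply (f_equal2 pair); ring. }
  apply Rle_trans with (1 := Cmod_le_abs _ _). rewrite Rabs_right by lra.
  assert (0 <= th * th * th) by (repeat apply Rmult_le_pos; lra).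
  assert (th * th * th * th <= th * th * th * 1) by (apply Rmult_le_compat_l; lra). lra.
Qed.

Lemma Cmod_lam (th : R) : 0 <= th <= 1 -> Cmod (lam th) <= 4 * (th * th).
Proof.
  intros Hth. pose proof (mu_bounds th Hth) as Hmu. pose proof (phi_bound th ltac:(lra)) as Hphi.
  pose proof (mu_nonneg th).
  apply Rle_trans with (1 := Cmod_le_abs _ _). rewrite Rabs_Ropp, Rabs_right by lra.
  assert (0 <= th * th) by (apply Rmult_le_pos; lra).
  assert (th * th * th <= th * th * 1) by (apply Rmult_le_compat_l; lra). lra.
Qed.

Lemma one_minus_cis_near (th : R) : 0 <= th <= 1 ->
  Cmod (1 - cis th + Ci * th)%C <= th * th /\ Cmod (1 - cis th)%C <= 2 * th.
Proof.
  intros Hth. pose proof (one_minus_cos_le th). pose proof (COS_bound th).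
  pose proof (sin_le_id th). pose proof (sin_ge_cubic th). pose proof (sin_ge_0 th).
  pose proof PI2_3_2 as Hpi. unfold PI2 in Hpi.
  assert (0 <= th * th) by (apply Rmult_le_pos; lra).
  assert (th * th * th <= th * th * 1) by (apply Rmult_le_compat_l; lra).
  assert (th * th <= th * 1) by (apply Rmult_le_compat_l; lra).
  split.
  - replace (1 - cis th + Ci * th)%C with ((1 - cos th, th - sin th) : C).
    2:{ unfold cis, Ci, Cminus, Cplus, Copp, Cmult, RtoC; cbn [fst snd].
        apply (f_equal2 pair); ring. }
    apply Rle_trans with (1 := Cmod_le_abs _ _). rewrite !Rabs_right by lra. lra.
  - replace (1 - cis th)%C with ((1 - cos th, - sin th) : C).
    2:{ unfold cis, Cminus, Cplus, Copp, RtoC; cbn [fst snd]. apply (f_equal2 pair); ring. }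
    apply Rle_trans with (1 := Cmod_le_abs _ _). rewrite Rabs_Ropp, !Rabs_right by lra. lra.
Qed.

Section Defect.

Variables (y th : R).
Hypothesis (Hy : 0 <= y <= 1) (Hth : 0 <= th <= 1).

(** If n' is the exponent after mixing, the old exponents are n' - y and n' + y - 1. Taking out r^n'
    leaves r^(-y) and r^y, together with an r^(-1) that [cis_rpow_opp_1] absorbs. *)
Let u : C := (rpow (- y) th - 1)%C.
Let w : C := (rpow y th - 1)%C.

Lemma u_near : Cmod (u + y * lam th) <= 60 * y * (th * th * th * th).
Proof.
  pose proof (rpow_taylor (- y) th) as H. rewrite Rabs_Ropp, Rabs_right in H by lra.
  replace (u + y * lam th)%C with (rpow (- y) th - 1 - (- y)%R * lam th)%C.
  - apply H; lra.
  - unfold u. rewrite RtoC_opp. ring.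
Qed.

Lemma w_near : Cmod (w - y * lam th) <= 60 * y * (th * th * th * th).
Proof.
  pose proof (rpow_taylor y th) as H. rewrite Rabs_right in H by lra.
  apply H; lra.
Qed.

Lemma Cmod_2_minus_cis : Cmod (2 - cis th)%C <= 3.
Proof.
  apply Rle_trans with (1 := Cmod_triangle _ _).
  rewrite Cmod_opp, Cmod_cis, Cmod_R, Rabs_right; lra.
Qed.

(** To leading order u = - y lam and w = y lam, so the mean is y (1 - cis th) lam, that is y (- i
    th) (- th^2). The term i y th^3 is exactly what the increment 6 y of the second component in
    [cum_mix] compensates, since that component is weighted by i th^3 / 6. *)
Lemma mean_near :
  Cmod ((cis th * u + (2 - cis th) * w) / 2 - Ci * RtoC (y * (th * th * th)))
    <= 130 * y * (th * th * th * th).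
Proof.
  pose proof u_near as Hu. pose proof w_near as Hw. pose proof Cmod_2_minus_cis as H2.
  pose proof (lam_near th Hth) as Hl. pose proof (Cmod_lam th Hth) as Hl2.
  destruct (one_minus_cis_near th Hth) as [He _].
  replace ((cis th * u + (2 - cis th) * w) / 2 - Ci * RtoC (y * (th * th * th)))%C with
    (y * ((1 - cis th + Ci * th) * lam th + - (Ci * th * (lam th + RtoC (th * th)))) +
      (RtoC (/ 2) * (cis th * (u + y * lam th) + (2 - cis th) * (w - y * lam th))))%C.
  2:{ rewrite RtoC_inv, !RtoC_mult by lra. field. }
  apply Rle_trans with (1 := Cmod_triangle _ _).
  set (t4 := th * th * th * th) in *.
  assert (A : Cmod (y * ((1 - cis th + Ci * th) * lam th +
     - (Ci * th * (lam th + RtoC (th * th))))) <= y * (10 * t4)).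
  { rewrite Cmod_mult, Cmod_R, Rabs_right by lra. apply Rmult_le_compat_l; [lra|].
    apply Rle_trans with (1 := Cmod_triangle _ _). rewrite Cmod_opp, !Cmod_mult.
    rewrite Cmod_Ci, Cmod_R, (Rabs_right th) by lra.
    replace (10 * t4) with ((th * th) * (4 * (th * th)) + 1 * th * (6 * (th * th * th)))
      by (unfold t4; ring).
    apply Rplus_le_compat.
    - apply Rmult_le_compat; try apply Cmod_ge_0; assumption.
    - apply Rmult_le_compat_l; [lra|exact Hl]. }
  assert (B : Cmod (RtoC (/ 2) * (cis th * (u + y * lam th) + (2 - cis th) * (w - y * lam th)))
    <= / 2 * (1 * (60 * y * t4) + 3 * (60 * y * t4))).
  { rewrite Cmod_mult, Cmod_R, Rabs_right by lra. apply Rmult_le_compat_l; [lra|].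
    apply Rle_trans with (1 := Cmod_triangle _ _). rewrite !Cmod_mult, Cmod_cis.
    apply Rplus_le_compat; [lra|].
    apply Rmult_le_compat; try apply Cmod_ge_0; assumption. }
  lra.
Qed.

(** Order th is enough here: this quantity only multiplies Wa - Wb, which comes with a further
    factor th^3. *)
Lemma difference_near :
  Cmod (2 * cis th - 2 + cis th * u - (2 - cis th) * w) <= 260 * th.
Proof.
  pose proof u_near as Hu. pose proof w_near as Hw. pose proof Cmod_2_minus_cis as H2.
  pose proof (Cmod_lam th Hth) as Hl2.
  destruct (one_minus_cis_near th Hth) as [_ He].
  assert (Hsq : th * th <= th * 1) by (apply Rmult_le_compat_l; lra).
  assert (Hc : th * th * th * th <= th).
  { replace (th * th * th * th) with (th * th * (th * th)) by ring.
    apply Rle_trans with (th * 1); [|lra]. apply Rmult_le_compat; nra. }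
  assert (Hy4 : y * (th * th * th * th) <= th).
  { apply Rle_trans with (1 * (th * th * th * th)); [|lra].
    apply Rmult_le_compat_r; [|lra]. repeat apply Rmult_le_pos; lra. }
  assert (Hly : Cmod (y * lam th) <= 4 * th).
  { rewrite Cmod_mult, Cmod_R, Rabs_right by lra. pose proof (Cmod_ge_0 (lam th)). nra. }
  assert (Hu' : Cmod u <= 64 * th).
  { replace u with ((u + y * lam th) + - (y * lam th))%C by ring.
    apply Rle_trans with (1 := Cmod_triangle _ _). rewrite Cmod_opp. lra. }
  assert (Hw' : Cmod w <= 64 * th).
  { replace w with ((w - y * lam th) + (y * lam th))%C by ring.
    apply Rle_trans with (1 := Cmod_triangle _ _). lra. }
  replace (2 * cis th - 2 + cis th * u - (2 - cis th) * w)%C with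
    (- (2 * (1 - cis th)) + (cis th * u + - ((2 - cis th) * w)))%C by ring.
  apply Rle_trans with (1 := Cmod_triangle _ _).
  apply Rle_trans with (4 * th + (1 * (64 * th) + 3 * (64 * th))); [|lra].
  apply Rplus_le_compat.
  - rewrite Cmod_opp, Cmod_mult, Cmod_R, Rabs_right; lra.
  - apply Rle_trans with (1 := Cmod_triangle _ _). rewrite Cmod_opp, !Cmod_mult, Cmod_cis.
    apply Rplus_le_compat; [lra|].
    apply Rmult_le_compat; try apply Cmod_ge_0; assumption.
Qed.

End Defect.

Definition approx (th : R) (p : R * R) : C :=
  (rpow (fst p) th * (1 + Ci * snd p * RtoC (th * th * th / 6)))%C.

(* Writing y = (1 + nu_b - nu_a) / 2 and S, D for the half sum and the difference of the
   second components, the defect is rpow (nu') times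
   (Z - i y th^3) + i th^3 / 6 * (Z S + Y D / 4), where Z and Y are as in [mean_near] and
   [difference_near]. The identity cis (- th) * rpow (-1) th = 2 - cis th makes everything
   except the last term vanish at y = 0. *)
Lemma approx_defect (th na Wa nb Wb : R) :
  0 <= th <= 1 -> 0 <= na -> 0 <= nb -> -1 <= nb - na <= 1 -> 0 <= Wa -> 0 <= Wb ->
  let y := (1 + (nb - na)) / 2 in
  Cmod (gamma_mix th (approx th (na, Wa)) (approx th (nb, Wb)) -
        approx th (cum_mix (na, Wa) (nb, Wb)))
    <= 130 * y * (th * th * th * th) +
       22 * y * (th * th * th * th * th * th) * ((Wa + Wb) / 2) +
       11 * (th * th * th * th) * Rabs (Wa - Wb).
Proof.
  intros Hth Hna Hnb HD HWa HWb y.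
  assert (Hy : 0 <= y <= 1) by (unfold y; lra).
  pose proof (mean_near y th Hy Hth) as HZ. pose proof (difference_near y th Hy Hth) as HY.
  set (u := (rpow (- y) th - 1)%C) in *. set (w := (rpow y th - 1)%C) in *.
  set (Z := ((cis th * u + (2 - cis th) * w) / 2)%C) in *.
  set (Y := (2 * cis th - 2 + cis th * u - (2 - cis th) * w)%C) in *.
  set (n' := (na + nb) / 2 + 1 / 2).
  replace (gamma_mix th (approx th (na, Wa)) (approx th (nb, Wb)) -
        approx th (cum_mix (na, Wa) (nb, Wb)))%C with
    (rpow n' th * ((Z - Ci * RtoC (y * (th * th * th))) +
      Ci * RtoC (th * th * th / 6) * (Z * RtoC ((Wa + Wb) / 2) + Y * RtoC (Wa - Wb) / 4)))%C.
  2:{ unfold gamma_mix, approx, cum_mix; cbn [fst snd].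
      replace na with (n' + - y) by (unfold n', y; field).
      replace nb with (n' + (y + -1)) at 1 by (unfold n', y; field).
      fold n'. rewrite (rpow_add n' (- y)), (rpow_add n' (y + -1)), (rpow_add y (-1)).
      replace ((n' + - y + nb) / 2 + 1 / 2) with n' by (unfold n', y; field).
      replace ((Wa + Wb) / 2 + 3 + 3 * (nb - (n' + - y))) with ((Wa + Wb) / 2 + 6 * y)
        by (unfold n', y; field).
      replace (y * (th * th * th)) with (6 * y * (th * th * th / 6)) by field.
      pose proof (cis_rpow_opp_1 th) as E.
      replace (rpow (- y) th) with (1 + u)%C by (unfold u; ring).
      replace (rpow y th) with (1 + w)%C by (unfold w; ring).
      generalize (th * th * th / 6). intros a.
      transitivity ((cis th * (rpow n' th * (1 + u) * (1 + Ci * Wa * a)) +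
        rpow n' th * (1 + w) * (cis (- th) * rpow (-1) th) * (1 + Ci * Wb * a)) / 2 -
        rpow n' th * (1 + Ci * RtoC ((Wa + Wb) / 2 + 6 * y) * a))%C.
      - rewrite E. unfold Z, Y.
        rewrite !RtoC_plus, !RtoC_minus, !RtoC_mult, !RtoC_div, !RtoC_plus by lra. field.
      - field. }
  rewrite Cmod_mult.
  assert (Hn' : Cmod (rpow n' th) <= 1) by (apply Cmod_rpow_le_1; unfold n'; lra).
  match goal with |- _ * Cmod ?X <= _ => apply Rle_trans with (1 * Cmod X);
    [apply Rmult_le_compat_r; [apply Cmod_ge_0|exact Hn']|rewrite Rmult_1_l] end.
  apply Rle_trans with (1 := Cmod_triangle _ _).
  set (t3 := th * th * th) in *.
  assert (Ht3 : 0 <= t3) by (unfold t3; repeat apply Rmult_le_pos; lra).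
  assert (Ht4 : t3 * th <= t3 * 1) by (apply Rmult_le_compat_l; lra).
  assert (HZ2 : Cmod Z <= 131 * (y * t3)).
  { replace Z with ((Z - Ci * RtoC (y * t3)) + Ci * RtoC (y * t3))%C by ring.
    apply Rle_trans with (1 := Cmod_triangle _ _).
    rewrite (Cmod_mult Ci), Cmod_Ci, Cmod_R, Rabs_right
      by (apply Rle_ge, Rmult_le_pos; lra).
    assert (y * (t3 * th) <= y * (t3 * 1)) by (apply Rmult_le_compat_l; lra). lra. }
  (* The constants 22 and 11 of the statement round up 131 / 6 and 260 / 24. *)
  apply Rle_trans with (130 * y * (t3 * th) +
    t3 / 6 * (131 * (y * t3) * ((Wa + Wb) / 2) + 260 * th * (Rabs (Wa - Wb) / 4))).
  - apply Rplus_le_compat; [exact HZ|].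
    rewrite !Cmod_mult, Cmod_Ci, Cmod_R, Rmult_1_l, (Rabs_right (t3 / 6)) by lra.
    apply Rmult_le_compat_l; [lra|].
    apply Rle_trans with (1 := Cmod_triangle _ _).
    apply Rplus_le_compat.
    + rewrite Cmod_mult, Cmod_R, (Rabs_right ((Wa + Wb) / 2)) by lra.
      apply Rmult_le_compat_r; lra.
    + rewrite Cmod_div, Cmod_mult, !Cmod_R, (Rabs_right 4) by (try apply RtoC_neq_0; lra).
      unfold Rdiv. rewrite Rmult_assoc. apply Rmult_le_compat_r; [|lra].
      pose proof (Rabs_pos (Wa - Wb)). lra.
  - pose proof (Rabs_pos (Wa - Wb)).
    assert (0 <= t3 * th * Rabs (Wa - Wb)) by (repeat apply Rmult_le_pos; lra).
    assert (0 <= y * t3 * t3 * ((Wa + Wb) / 2)) by (repeat apply Rmult_le_pos; lra).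
    replace (t3 * th * th * th) with (t3 * t3) by (unfold t3; ring).
    lra.
Qed.

(** * Accumulation of the defects along the digits *)

Definition error_scale (th B : R) (m : nat) : R :=
  400 * (1 + INR m) * (th * th * th * th + B * (th * th * th * th * th * th)).

Lemma error_scale_nonneg (th B : R) (m : nat) : 0 <= th -> 0 <= B -> 0 <= error_scale th B m.
Proof.
  intros Hth HB. pose proof (pos_INR m). unfold error_scale.
  assert (0 <= th * th * th * th) by (repeat apply Rmult_le_pos; lra).
  assert (0 <= th * th * th * th * th * th) by (repeat apply Rmult_le_pos; lra).
  repeat apply Rmult_le_pos; try lra.
  apply Rplus_le_le_0_compat; [lra|]. now apply Rmult_le_pos.
Qed.

Lemma approx_defect_cum (th B : R) (m : nat) (l : list bool) :
  0 <= th <= 1 ->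
  let (p, q) := cum l in
  12 * fst p <= B -> 12 * fst q <= B ->
  Cmod (gamma_mix th (approx th p) (approx th q) - approx th (cum_mix p q))
    <= error_scale th B m * ((1 + (fst q - fst p)) / 2 + / 2 / 2 ^ m).
Proof.
  intros Hth.
  pose proof (cum_nu_dist l) as H1. pose proof (cum_W_range l) as H2.
  pose proof (proj2 (cum_W_dist l) m) as H3.
  destruct (cum l) as [[na Wa] [nb Wb]]. cbn [fst snd] in *. intros HBa HBb.
  apply Rle_trans with (1 := approx_defect th na Wa nb Wb Hth ltac:(lra) ltac:(lra) H1
    ltac:(lra) ltac:(lra)).
  cbv zeta. set (y := (1 + (nb - na)) / 2).
  assert (Hy : 0 <= y <= 1) by (unfold y; lra).
  replace (1 + (nb - na)) with (2 * y) in H3 by (unfold y; field).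
  unfold error_scale. set (t4 := th * th * th * th).
  replace (t4 * th * th) with (t4 * (th * th)) by ring.
  assert (Ht4 : 0 <= t4) by (unfold t4; repeat apply Rmult_le_pos; lra).
  assert (Ht2 : 0 <= th * th) by (apply Rmult_le_pos; lra).
  set (t6 := t4 * (th * th)). assert (Ht6 : 0 <= t6) by (apply Rmult_le_pos; lra).
  assert (He : 0 < / 2 ^ m) by (apply Rinv_0_lt_compat, pow_lt; lra).
  set (e := / 2 ^ m) in *. unfold Rdiv in *. fold e in H3 |- *.
  pose proof (pos_INR m) as Hm. set (k := INR m) in *.
  assert (A1 : 22 * y * t6 * ((Wa + Wb) * / 2) <= 22 * y * t6 * B).
  { apply Rmult_le_compat_l; [repeat apply Rmult_le_pos; lra|lra]. }
  assert (A2 : 11 * t4 * Rabs (Wa - Wb) <= 11 * t4 * ((12 + 6 * k) * (2 * y) + 12 * e)).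
  { apply Rmult_le_compat_l; [lra|exact H3]. }
  assert (P1 : 0 <= y * t4) by (apply Rmult_le_pos; lra).
  assert (P2 : 0 <= k * (y * t4)) by (apply Rmult_le_pos; lra).
  assert (P3 : 0 <= t4 * e) by (apply Rmult_le_pos; lra).
  assert (P4 : 0 <= k * (t4 * e)) by (apply Rmult_le_pos; lra).
  assert (HB : 0 <= B) by lra.
  assert (P5 : 0 <= y * t6 * B) by (repeat apply Rmult_le_pos; lra).
  assert (P6 : 0 <= k * (y * t6 * B)) by (apply Rmult_le_pos; lra).
  assert (P7 : 0 <= e * t6 * B) by (repeat apply Rmult_le_pos; lra).
  assert (P8 : 0 <= k * (e * t6 * B)) by (apply Rmult_le_pos; lra).
  (* The coefficients of y t4 add up to 130 + 264 + 132 k and that of t4 e is 132; the constant 400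
     leaves room for 400 (1 + k) and 200 (1 + k). *)
  lra.
Qed.

Definition error_at (th : R) (g : C) (p : R * R) : R := Cmod (g - approx th p).

Lemma gamma_mix_error (th : R) (a b : C) (p q : R * R) :
  error_at th (gamma_mix th a b) (cum_mix p q) <=
  (error_at th a p + error_at th b q) / 2 +
  Cmod (gamma_mix th (approx th p) (approx th q) - approx th (cum_mix p q)).
Proof.
  unfold error_at.
  replace (gamma_mix th a b - approx th (cum_mix p q))%C with
    (gamma_mix th (a - approx th p) (b - approx th q) +
     (gamma_mix th (approx th p) (approx th q) - approx th (cum_mix p q)))%C
    by (unfold gamma_mix; field).
  apply Rle_trans with (1 := Cmod_triangle _ _). apply Rplus_le_compat_r.
  apply gamma_mix_le; apply Rle_refl.
Qed.

(* Both sides satisfy the same recursion up to the defect, and the defect is bounded by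
   the increments of [snd] and [fst] in [cum]. *)
Lemma gamma_approx (th B : R) (m : nat) (l : list bool) :
  0 <= th <= 1 ->
  let (p, q) := cum l in
  12 * fst p <= B -> 12 * fst q <= B ->
  error_at th (fst (gamma th l)) p <= error_scale th B m * (snd p + fst p / 2 ^ m) /\
  error_at th (snd (gamma th l)) q <= error_scale th B m * (snd q + fst q / 2 ^ m).
Proof.
  intros Hth. assert (He : 0 < / 2 ^ m) by (apply Rinv_0_lt_compat, pow_lt; lra).
  induction l as [|d l IH].
  - pose proof (approx_defect_cum th B m nil Hth) as Hdef. cbn in Hdef |- *.
    intros HBa HBb. specialize (Hdef HBa HBb).
    assert (Hs := error_scale_nonneg th B m ltac:(lra) ltac:(lra)).
    assert (H0 : error_at th (fst (gamma_init th)) (0, 0) = 0).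
    { unfold error_at, approx; cbn [fst snd gamma_init]. rewrite rpow_0.
      replace (1 - 1 * (1 + Ci * 0 * RtoC (th * th * th / 6)))%C with (RtoC 0) by ring.
      apply Cmod_0. }
    split.
    + change (error_at th (fst (gamma_init th)) (0, 0) <=
        error_scale th B m * (0 + 0 / 2 ^ m)). rewrite H0.
      right. unfold Rdiv. ring.
    + change (error_at th (snd (gamma_init th)) (1, 12) <=
        error_scale th B m * (12 + 1 / 2 ^ m)).
      pose proof (gamma_mix_error th (fst (gamma_init th)) (snd (gamma_init th)) (0, 0) (1, 12))
        as H.
      rewrite gamma_init_fixed, H0 in H.
      replace (cum_mix (0, 0) (1, 12)) with ((1, 12) : R * R) in *
        by (unfold cum_mix; cbn; apply (f_equal2 pair); lra).
      unfold Rdiv in *. set (e := / 2 ^ m) in *. set (E := error_scale th B m) in *.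
      assert (0 <= E * e) by (apply Rmult_le_pos; lra). lra.
  - pose proof (approx_defect_cum th B m l Hth) as Hdef.
    pose proof (cum_nu_dist l) as HD. pose proof (cum_W_range l) as HW.
    rewrite cum_cons.
    change (gamma th (d :: l)) with (digit_step (gamma_mix th) d (gamma th l)).
    destruct (cum l) as [p q]. cbn [fst snd] in *.
    destruct (gamma th l) as [a b]. cbn [fst snd] in *.
    assert (Hmix : 12 * fst p <= B -> 12 * fst q <= B ->
      error_at th (gamma_mix th a b) (cum_mix p q) <=
      error_scale th B m * (snd (cum_mix p q) + fst (cum_mix p q) / 2 ^ m)).
    { intros HBa HBb. specialize (IH HBa HBb). specialize (Hdef HBa HBb).
      pose proof (gamma_mix_error th a b p q) as H.
      assert (Hs := error_scale_nonneg th B m ltac:(lra) ltac:(lra)).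
      unfold cum_mix at 2 3. cbn [fst snd].
      unfold Rdiv in *. set (e := / 2 ^ m) in *. set (E := error_scale th B m) in *.
      assert (0 <= E * (1 + (fst q - fst p))) by (apply Rmult_le_pos; lra). lra. }
    destruct d; cbn [digit_step fst snd]; intros HBa HBb.
    (* The mean plus 1/2 is at least the larger of two numbers at distance at most 1, so first
       components never decrease and a bound at the end of the fold holds all along. *)
    + assert (HB' : 12 * fst p <= B) by (cbn in HBa; lra).
      split; [apply Hmix; assumption|apply IH; assumption].
    + assert (HB' : 12 * fst q <= B) by (cbn in HBb; lra).
      split; [apply IH; assumption|apply Hmix; assumption].
Qed.

(** * Fourier inversion *)

Fixpoint dirichlet_nat (n : nat) (th : R) : R :=
  match n with
  | O => 1
  | S k => dirichlet_nat k th + 2 * cos (INR (S k) * th)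
  end.

(** The Dirichlet kernel, continued to negative indices by D_m = - D_(-m-1), so that it equals sin
    ((m + 1/2) th) / sin (th / 2) for every integer m, with the quotient extended continuously at th
    = 0. *)
Definition dirichlet (m : Z) (th : R) : R :=
  if Z.leb 0 m then dirichlet_nat (Z.to_nat m) th else - dirichlet_nat (Z.to_nat (- m - 1)) th.

Lemma dirichlet_succ (m : Z) (th : R) :
  dirichlet (m + 1) th = dirichlet m th + 2 * cos (IZR (m + 1) * th).
Proof.
  unfold dirichlet.
  destruct (Z.leb_spec 0 m) as [H|H]; destruct (Z.leb_spec 0 (m + 1)) as [H'|H']; try lia.
  - replace (Z.to_nat (m + 1)) with (S (Z.to_nat m)) by lia. cbn [dirichlet_nat].
    rewrite INR_IZR_INZ. now replace (Z.of_nat (S (Z.to_nat m))) with (m + 1)%Z by lia.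
  - replace m with (-1)%Z by lia. cbn. rewrite Rmult_0_l, cos_0. ring.
  - replace (Z.to_nat (- m - 1)) with (S (Z.to_nat (- (m + 1) - 1))) by lia.
    cbn [dirichlet_nat]. rewrite INR_IZR_INZ.
    replace (Z.of_nat (S (Z.to_nat (- (m + 1) - 1)))) with (- (m + 1))%Z by lia.
    rewrite opp_IZR, <- Ropp_mult_distr_l, cos_neg. ring.
Qed.

Lemma dirichlet_0 (th : R) : dirichlet 0 th = 1.
Proof. reflexivity. Qed.

Lemma Z_step_ind (P : Z -> Prop) :
  P 0%Z -> (forall m, P m <-> P (m + 1)%Z) -> forall m, P m.
Proof.
  intros H0 HS m. induction m as [|m Hm|m Hm] using Z.peano_ind; [exact H0| |].
  - rewrite <- Z.add_1_r. exact (proj1 (HS m) Hm).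
  - apply (proj2 (HS _)). now replace (Z.pred m + 1)%Z with m by lia.
Qed.

Lemma dirichlet_sin (m : Z) (th : R) :
  sin (th / 2) * dirichlet m th = sin ((IZR m + / 2) * th).
Proof.
  revert m. apply Z_step_ind.
  - rewrite dirichlet_0, Rmult_1_r. f_equal. field.
  - intros m. rewrite dirichlet_succ.
    enough (sin ((IZR (m + 1) + / 2) * th) - sin ((IZR m + / 2) * th) =
      sin (th / 2) * (2 * cos (IZR (m + 1) * th))) by lra.
    rewrite plus_IZR.
    replace ((IZR m + 1 + / 2) * th) with ((IZR m + 1) * th + th / 2) by field.
    replace ((IZR m + / 2) * th) with ((IZR m + 1) * th - th / 2) by field.
    rewrite sin_plus, sin_minus. ring.
Qed.

Lemma dirichlet_three_term (m : Z) (th : R) :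
  dirichlet (m + 1) th + dirichlet (m - 1) th = 2 * cos th * dirichlet m th.
Proof.
  revert m. apply Z_step_ind.
  - rewrite dirichlet_succ, dirichlet_0.
    change (dirichlet (0 - 1) th) with (- (1)). rewrite Rmult_1_l. ring.
  - intros m. replace (m + 1 - 1)%Z with m by lia.
    pose proof (dirichlet_succ (m - 1) th) as H. replace (m - 1 + 1)%Z with m in H by lia.
    rewrite (dirichlet_succ (m + 1)), (dirichlet_succ m), H.
    enough (cos (IZR (m + 1 + 1) * th) + cos (IZR m * th) =
      2 * cos th * cos (IZR (m + 1) * th)) by lra.
    rewrite !plus_IZR.
    replace ((IZR m + 1 + 1) * th) with ((IZR m + 1) * th + th) by ring.
    replace (IZR m * th) with ((IZR m + 1) * th - th) by ring.
    rewrite cos_plus, cos_minus. ring.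
Qed.

Lemma dirichlet_continuous (m : Z) (th : R) : continuous (dirichlet m) th.
Proof.
  revert m. apply Z_step_ind.
  - apply continuous_const.
  - intros m.
    assert (Hc : continuous (fun t => 2 * cos (IZR (m + 1) * t)) th).
    { apply (ex_derive_continuous (fun t => 2 * cos (IZR (m + 1) * t))). auto_derive. exact I. }
    split; intros H.
    + apply continuous_ext with (fun t => plus (dirichlet m t) (2 * cos (IZR (m + 1) * t))).
      { intros t. symmetry. apply dirichlet_succ. }
      now apply (continuous_plus (dirichlet m)).
    + apply continuous_ext with
        (fun t => minus (dirichlet (m + 1) t) (2 * cos (IZR (m + 1) * t))).
      { intros t. rewrite dirichlet_succ. unfold minus, plus, opp; cbn. ring. }
      now apply (continuous_minus (dirichlet (m + 1))).
Qed.

Lemma dirichlet_bound (m : Z) (th : R) : Rabs (dirichlet m th) <= 2 * IZR (Z.abs m) + 1.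
Proof.
  assert (H : forall n, Rabs (dirichlet_nat n th) <= 2 * INR n + 1).
  { induction n as [|n IH]; cbn [dirichlet_nat]; [cbn; rewrite Rabs_R1; lra|].
    rewrite S_INR at 2. apply Rle_trans with (1 := Rabs_triang _ _).
    pose proof (COS_bound (INR (S n) * th)).
    assert (Rabs (2 * cos (INR (S n) * th)) <= 2) by (apply Rabs_le; lra). lra. }
  unfold dirichlet. destruct (Z.leb_spec 0 m) as [Hm|Hm].
  - apply Rle_trans with (1 := H _). rewrite INR_IZR_INZ, Z2Nat.id, Z.abs_eq by lia. lra.
  - rewrite Rabs_Ropp. apply Rle_trans with (1 := H _).
    rewrite INR_IZR_INZ, Z2Nat.id by lia.
    assert (IZR (- m - 1) <= IZR (Z.abs m)) by (apply IZR_le; lia). lra.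
Qed.

Lemma dirichlet_nat_integral (n : nat) : is_RInt (dirichlet_nat n) 0 PI PI.
Proof.
  induction n as [|n IH].
  - cbn [dirichlet_nat]. replace PI with (scal (PI - 0) 1) at 2
      by (unfold scal; cbn; unfold mult; cbn; ring).
    apply (is_RInt_const 0 PI 1).
  - cbn [dirichlet_nat]. replace PI with (plus PI 0) at 2 by apply Rplus_0_r.
    apply (is_RInt_plus (dirichlet_nat n)); [exact IH|].
    assert (Hk : INR (S n) <> 0) by (apply not_0_INR; lia).
    assert (Hs : sin (INR (S n) * PI) = 0).
    { apply sin_eq_0_1. exists (Z.of_nat (S n)). now rewrite INR_IZR_INZ. }
    revert Hk Hs. generalize (INR (S n)). intros k Hk Hs.
    set (F := fun x => 2 * sin (k * x) / k).
    replace 0 with (minus (F PI) (F 0)) at 2.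
    + apply (is_RInt_derive F).
      * intros x _. unfold F. auto_derive; [exact I|field; exact Hk].
      * intros x _. apply (ex_derive_continuous (fun th => 2 * cos (k * th))).
        auto_derive. exact I.
    + unfold F, minus, plus, opp; cbn. rewrite Rmult_0_r, sin_0, Hs. field. exact Hk.
Qed.

Lemma dirichlet_integral (m : Z) :
  is_RInt (dirichlet m) 0 PI (if Z.leb 0 m then PI else - PI).
Proof.
  unfold dirichlet. destruct (Z.leb 0 m).
  - apply dirichlet_nat_integral.
  - apply (is_RInt_opp (dirichlet_nat _)). apply dirichlet_nat_integral.
Qed.

(** * Tail probabilities as integrals *)

Definition kernel_mix (F G : Z -> R -> R) (j : Z) (th : R) : R :=
  (F (j - 1)%Z th + G (j + 1)%Z th) / 2.

(** The second component comes from rationalising: e^(i th) / (2 - e^(-i th)) = (2 e^(i th) - e^(2 i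
    th)) / [denom th], each exponential then turning into a Dirichlet kernel. *)
Definition kernel_init : (Z -> R -> R) * (Z -> R -> R) :=
  (fun j => dirichlet (- j),
   fun j th => (2 * dirichlet (1 - j) th - dirichlet (2 - j) th) / denom th).

(* The integral over [0, PI] of [fst (kernel l) j] is 2 PI (p - 1/2), where p is the limiting
   density of the n such that s(n+t) - s(n) >= j for t = [value l]; see [kernel_sin] for
   the closed form. The recursion avoids the removable singularity at 0. *)
Definition kernel (l : list bool) : (Z -> R -> R) * (Z -> R -> R) :=
  digit_fold kernel_mix kernel_init l.

Lemma kernel_init_fixed (j : Z) (th : R) :
  snd kernel_init j th = kernel_mix (fst kernel_init) (snd kernel_init) j th.
Proof.
  unfold kernel_mix, kernel_init; cbn [fst snd].
  replace (- (j - 1))%Z with (1 - j)%Z by lia.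
  replace (1 - (j + 1))%Z with (1 - j - 1)%Z by lia.
  replace (2 - (j + 1))%Z with (1 - j)%Z by lia.
  replace (2 - j)%Z with (1 - j + 1)%Z by lia.
  pose proof (dirichlet_three_term (1 - j) th) as H. pose proof (denom_range th).
  replace (dirichlet (1 - j + 1) th) with
    (2 * cos th * dirichlet (1 - j) th - dirichlet (1 - j - 1) th) by lra.
  unfold denom in *. field. lra.
Qed.

Lemma kernel_continuous (l : list bool) (j : Z) (th : R) :
  continuous (fst (kernel l) j) th /\ continuous (snd (kernel l) j) th.
Proof.
  revert j. induction l as [|d l IH]; intros j.
  - split; [apply dirichlet_continuous|]. cbn.
    apply (continuous_mult (fun th => 2 * dirichlet (1 - j) th - dirichlet (2 - j) th)
      (fun th => / denom th)).
    + apply (continuous_minus (fun th => 2 * dirichlet (1 - j) th)).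
      * apply (continuous_scal_r 2 (dirichlet (1 - j))). apply dirichlet_continuous.
      * apply dirichlet_continuous.
    + apply (ex_derive_continuous (fun th => / denom th)). pose proof (denom_range th).
      unfold denom in *. auto_derive. lra.
  - assert (Hm : continuous (kernel_mix (fst (kernel l)) (snd (kernel l)) j) th).
    { unfold kernel_mix.
      apply (continuous_mult (fun th => fst (kernel l) (j - 1)%Z th + snd (kernel l) (j + 1)%Z th)
        (fun _ => / 2)); [|apply continuous_const].
      apply (continuous_plus (fst (kernel l) (j - 1)%Z)); apply IH. }
    destruct d; split; try exact Hm; apply IH.
Qed.

Lemma gamma_init_denom (th : R) :
  (snd (gamma_init th) * denom th = 2 * cis th - cis th * cis th)%C.
Proof.
  cbn [snd gamma_init].
  assert (H : RtoC (denom th) = ((2 - cis (- th)) * (2 - cis th))%C).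
  { unfold denom, cis, Cmult, Cminus, Cplus, Copp, RtoC; cbn [fst snd].
    rewrite cos_neg, sin_neg. pose proof (sin2_cos2 th) as Hsc. unfold Rsqr in Hsc.
    apply (f_equal2 pair); [nra|ring]. }
  rewrite H. pose proof (cis_denom_neq_0 th). field. assumption.
Qed.

(** Moving j to j - 1 or j + 1 multiplies [cis ((/ 2 - IZR j) * th)] by e^(i th) or e^(-i th), which
    are the factors in [gamma_mix]; both sides thus obey the same recursion, and only t = 0 and t =
    1 need computation. *)
Lemma kernel_sin (l : list bool) (j : Z) (th : R) :
  sin (th / 2) * fst (kernel l) j th = snd (fst (gamma th l) * cis ((/ 2 - IZR j) * th))%C /\
  sin (th / 2) * snd (kernel l) j th = snd (snd (gamma th l) * cis ((/ 2 - IZR j) * th))%C.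
Proof.
  revert j. induction l as [|d l IH]; intros j.
  - change (kernel nil) with kernel_init. change (gamma th nil) with (gamma_init th).
    split.
    + cbn [fst kernel_init gamma_init]. rewrite dirichlet_sin, opp_IZR, Cmult_1_l.
      cbn [snd cis]. f_equal. ring.
    + pose proof (denom_range th) as Hd. pose proof (gamma_init_denom th) as H.
      set (g := snd (gamma_init th)) in *. cbn [snd kernel_init].
      apply Rmult_eq_reg_l with (denom th); [|lra].
      replace (denom th * snd (g * cis ((/ 2 - IZR j) * th))%C) with
        (snd (g * denom th * cis ((/ 2 - IZR j) * th))%C).
      2:{ unfold Cmult, RtoC; cbn [fst snd]. ring. }
      rewrite H.
      replace (denom th * (sin (th / 2) *
        ((2 * dirichlet (1 - j) th - dirichlet (2 - j) th) / denom th))) with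
        (2 * (sin (th / 2) * dirichlet (1 - j) th) - sin (th / 2) * dirichlet (2 - j) th)
        by (field; lra).
      rewrite !dirichlet_sin.
      replace ((2 * cis th - cis th * cis th) * cis ((/ 2 - IZR j) * th))%C with
        (2 * cis ((IZR (1 - j) + / 2) * th) - cis ((IZR (2 - j) + / 2) * th))%C.
      * unfold Cminus, Cmult, Cplus, Copp, cis, RtoC; cbn [fst snd]. ring.
      * rewrite !minus_IZR.
        replace ((1 - IZR j + / 2) * th) with (th + (/ 2 - IZR j) * th) by ring.
        replace ((2 - IZR j + / 2) * th) with (th + (th + (/ 2 - IZR j) * th)) by ring.
        rewrite !cis_add. ring.
  - change (kernel (d :: l)) with (digit_step kernel_mix d (kernel l)).
    change (gamma th (d :: l)) with (digit_step (gamma_mix th) d (gamma th l)).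
    assert (Hm : sin (th / 2) * kernel_mix (fst (kernel l)) (snd (kernel l)) j th =
      snd (gamma_mix th (fst (gamma th l)) (snd (gamma th l)) * cis ((/ 2 - IZR j) * th))%C).
    { unfold kernel_mix.
      replace (sin (th / 2) * ((fst (kernel l) (j - 1)%Z th + snd (kernel l) (j + 1)%Z th) / 2))
        with ((sin (th / 2) * fst (kernel l) (j - 1)%Z th +
               sin (th / 2) * snd (kernel l) (j + 1)%Z th) / 2) by field.
      rewrite (proj1 (IH _)), (proj2 (IH _)). unfold gamma_mix.
      rewrite minus_IZR, plus_IZR.
      replace ((/ 2 - (IZR j - 1)) * th) with (th + (/ 2 - IZR j) * th) by ring.
      replace ((/ 2 - (IZR j + 1)) * th) with (- th + (/ 2 - IZR j) * th) by ring.
      rewrite !cis_add.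
      set (a := fst (gamma th l)). set (b := snd (gamma th l)).
      set (v := cis ((/ 2 - IZR j) * th)).
      replace ((cis th * a + cis (- th) * b) / 2 * v)%C with
        (RtoC (/ 2) * (a * (cis th * v) + b * (cis (- th) * v)))%C
        by (rewrite RtoC_inv by lra; field).
      generalize (a * (cis th * v))%C (b * (cis (- th) * v))%C. intros p q.
      unfold Cmult, Cplus, RtoC; cbn [fst snd]. field. }
    destruct d; cbn [digit_step fst snd]; split; try exact Hm; apply IH.
Qed.

Lemma kernel_ex_RInt (l : list bool) (j : Z) (a b : R) :
  ex_RInt (fst (kernel l) j) a b /\ ex_RInt (snd (kernel l) j) a b.
Proof.
  split; apply (ex_RInt_continuous (V := R_CompleteNormedModule));
    intros; apply kernel_continuous.
Qed.

Lemma kernel_bound (l : list bool) (j : Z) (t : R) :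
  Rabs (fst (kernel l) j t) <= 6 * (IZR (Z.abs j) + INR (length l)) + 11 /\
  Rabs (snd (kernel l) j t) <= 6 * (IZR (Z.abs j) + INR (length l)) + 11.
Proof.
  revert j. induction l as [|d l IH]; intros j.
  - assert (Hj : 0 <= IZR (Z.abs j)) by (apply IZR_le; lia). split.
    + apply Rle_trans with (1 := dirichlet_bound (- j) t).
      rewrite Z.abs_opp. cbn. lra.
    + change (Rabs ((2 * dirichlet (1 - j) t - dirichlet (2 - j) t) / denom t) <=
        6 * (IZR (Z.abs j) + 0) + 11).
      pose proof (denom_range t). pose proof (dirichlet_bound (1 - j) t) as H1.
      pose proof (dirichlet_bound (2 - j) t) as H2.
      assert (IZR (Z.abs (1 - j)) <= IZR (Z.abs j) + 1)
        by (rewrite <- plus_IZR; apply IZR_le; lia).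
      assert (IZR (Z.abs (2 - j)) <= IZR (Z.abs j) + 2)
        by (rewrite <- plus_IZR; apply IZR_le; lia).
      rewrite Rabs_div, (Rabs_right (denom t)) by lra.
      apply Rle_div_l; [lra|].
      apply Rle_trans with (6 * IZR (Z.abs j) + 11); [|nra].
      apply Rle_trans with (1 := Rabs_triang _ _).
      rewrite Rabs_Ropp, Rabs_mult, (Rabs_right 2) by lra. lra.
  - change (kernel (d :: l)) with (digit_step kernel_mix d (kernel l)).
    cbn [length]. rewrite S_INR.
    assert (Hm : Rabs (kernel_mix (fst (kernel l)) (snd (kernel l)) j t) <=
      6 * (IZR (Z.abs j) + (INR (length l) + 1)) + 11).
    { unfold kernel_mix. rewrite Rabs_div, (Rabs_right 2) by lra.
      apply Rle_div_l; [lra|]. apply Rle_trans with (1 := Rabs_triang _ _).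
      pose proof (proj1 (IH (j - 1)%Z)). pose proof (proj2 (IH (j + 1)%Z)).
      assert (IZR (Z.abs (j - 1)) <= IZR (Z.abs j) + 1)
        by (rewrite <- plus_IZR; apply IZR_le; lia).
      assert (IZR (Z.abs (j + 1)) <= IZR (Z.abs j) + 1)
        by (rewrite <- plus_IZR; apply IZR_le; lia). lra. }
    destruct (IH j) as [H1 H2]. destruct d; cbn [digit_step fst snd]; split; lra.
Qed.

Definition tail_prob (F : Z -> R -> R) (j : Z) : R := / 2 + RInt (F j) 0 PI / (2 * PI).

Lemma tail_prob_mix (F G : Z -> R -> R) (j : Z) :
  (forall i, ex_RInt (F i) 0 PI) -> (forall i, ex_RInt (G i) 0 PI) ->
  tail_prob (kernel_mix F G) j = tail_mix (tail_prob F) (tail_prob G) j.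
Proof.
  intros HF HG. unfold tail_prob, tail_mix.
  assert (E : RInt (kernel_mix F G j) 0 PI =
    (RInt (F (j - 1)%Z) 0 PI + RInt (G (j + 1)%Z) 0 PI) / 2).
  { rewrite (RInt_ext _ (fun t => scal (/ 2) (plus (F (j - 1)%Z t) (G (j + 1)%Z t)))).
    2:{ intros t _. unfold kernel_mix, scal, plus; cbn. unfold mult; cbn. field. }
    rewrite (RInt_scal (fun t => plus (F (j - 1)%Z t) (G (j + 1)%Z t)))
      by now apply (ex_RInt_plus (F (j - 1)%Z)).
    rewrite (RInt_plus (F (j - 1)%Z)) by auto.
    unfold scal, plus; cbn. unfold mult; cbn. field. }
  rewrite E. field. apply PI_neq0.
Qed.

Lemma tail_prob_fold (l : list bool) (j : Z) :
  let c := digit_fold tail_mix (tail_prob (fst kernel_init), tail_prob (snd kernel_init)) l in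
  fst c j = tail_prob (fst (kernel l)) j /\ snd c j = tail_prob (snd (kernel l)) j.
Proof.
  cbv zeta. revert j. induction l as [|d l IH]; intros j; [now split|].
  change (kernel (d :: l)) with (digit_step kernel_mix d (kernel l)).
  set (c0 := (tail_prob (fst kernel_init), tail_prob (snd kernel_init))) in *.
  change (digit_fold tail_mix c0 (d :: l)) with
    (digit_step tail_mix d (digit_fold tail_mix c0 l)).
  clearbody c0.
  assert (Hm : tail_mix (fst (digit_fold tail_mix c0 l)) (snd (digit_fold tail_mix c0 l)) j =
    tail_prob (kernel_mix (fst (kernel l)) (snd (kernel l))) j).
  { rewrite (tail_prob_mix (fst (kernel l)) (snd (kernel l)) j
      (fun i => proj1 (kernel_ex_RInt l i 0 PI)) (fun i => proj2 (kernel_ex_RInt l i 0 PI))).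
    transitivity ((fst (digit_fold tail_mix c0 l) (j - 1)%Z +
      snd (digit_fold tail_mix c0 l) (j + 1)%Z) / 2); [reflexivity|].
    rewrite (proj1 (IH (j - 1)%Z)), (proj2 (IH (j + 1)%Z)).
    reflexivity. }
  destruct d; cbn [digit_step fst snd]; split; try exact Hm; apply IH.
Qed.

Lemma tail_prob_init_0 (j : Z) :
  tail_prob (fst kernel_init) j = if Z.leb j 0 then 1 else 0.
Proof.
  unfold tail_prob, kernel_init; cbn [fst].
  rewrite (is_RInt_unique _ _ _ _ (dirichlet_integral (- j))).
  pose proof PI_neq0.
  replace (Z.leb 0 (- j)) with (Z.leb j 0) by (apply Zleb_ext; lia).
  destruct (Z.leb j 0); field; assumption.
Qed.

Lemma tail_prob_init_1_fixed (j : Z) :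
  tail_prob (snd kernel_init) j =
  tail_mix (tail_prob (fst kernel_init)) (tail_prob (snd kernel_init)) j.
Proof.
  rewrite <- (tail_prob_mix (fst kernel_init) (snd kernel_init) j
    (fun i => proj1 (kernel_ex_RInt nil i 0 PI))
    (fun i => proj2 (kernel_ex_RInt nil i 0 PI))).
  unfold tail_prob. do 2 f_equal. apply RInt_ext. intros t _. apply kernel_init_fixed.
Qed.

Lemma tail_prob_init_1_growth (j : Z) :
  Rabs (tail_prob (snd kernel_init) j) <= 6 * (IZR (Z.abs j) + 1).
Proof.
  pose proof PI_RGT_0 as Hpi.
  assert (Hb : Rabs (RInt (snd kernel_init j) 0 PI) <= (PI - 0) * (6 * IZR (Z.abs j) + 11)).
  { apply abs_RInt_le_const; [lra|apply (proj2 (kernel_ex_RInt nil j 0 PI))|].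
    intros t _. pose proof (proj2 (kernel_bound nil j t)) as H. cbn in H.
    rewrite Rplus_0_r in H. exact H. }
  unfold tail_prob. apply Rle_trans with (1 := Rabs_triang _ _).
  unfold Rdiv. rewrite Rabs_mult, (Rabs_right (/ 2)), (Rabs_right (/ (2 * PI)))
    by (apply Rle_ge, Rlt_le, Rinv_0_lt_compat; lra).
  apply Rle_trans with (/ 2 + (PI - 0) * (6 * IZR (Z.abs j) + 11) * / (2 * PI)).
  - apply Rplus_le_compat_l, Rmult_le_compat_r; [|exact Hb].
    apply Rlt_le, Rinv_0_lt_compat; lra.
  - replace ((PI - 0) * (6 * IZR (Z.abs j) + 11) * / (2 * PI)) with
      ((6 * IZR (Z.abs j) + 11) / 2) by (field; lra).
    assert (0 <= IZR (Z.abs j)) by (apply IZR_le; lia). lra.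
Qed.

Lemma tail_prob_init_1_range (j : Z) : 0 <= tail_prob (snd kernel_init) j <= 1.
Proof.
  assert (Hc0 : forall i, 0 <= tail_prob (fst kernel_init) i <= 1).
  { intros i. rewrite tail_prob_init_0. destruct (Z.leb i 0); lra. }
  split.
  - enough (- tail_prob (snd kernel_init) j <= 0) by lra.
    apply (nonpos_of_halving (fun j => - tail_prob (snd kernel_init) j) 6).
    + intros i. rewrite (tail_prob_init_1_fixed i). unfold tail_mix.
      pose proof (Hc0 (i - 1)%Z). lra.
    + intros i. pose proof (tail_prob_init_1_growth i) as H.
      apply Rabs_le_between in H. lra.
  - enough (tail_prob (snd kernel_init) j - 1 <= 0) by lra.
    apply (nonpos_of_halving (fun j => tail_prob (snd kernel_init) j - 1) 6).
    + intros i. rewrite (tail_prob_init_1_fixed i). unfold tail_mix.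
      pose proof (Hc0 (i - 1)%Z). lra.
    + intros i. pose proof (tail_prob_init_1_growth i) as H.
      apply Rabs_le_between in H. lra.
Qed.

Lemma dens_limit_of_kernel (l : list bool) :
  0 < RInt (fst (kernel l) 0%Z) 0 PI ->
  exists c : R, is_lim_seq (dens (value l)) c /\ c > 1 / 2.
Proof.
  intros H. exists (tail_prob (fst (kernel l)) 0%Z). split.
  - rewrite <- (proj1 (tail_prob_fold l 0)). apply dens_limit.
    + apply tail_prob_init_0.
    + apply tail_prob_init_1_range.
    + apply tail_prob_init_1_fixed.
  - unfold tail_prob. pose proof PI_RGT_0.
    assert (0 < RInt (fst (kernel l) 0%Z) 0 PI / (2 * PI)) by (apply Rdiv_lt_0_compat; lra).
    lra.
Qed.

(** * The integral of the reference *)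

Definition ref_kernel (x th : R) : R := snd (rpow x th * cis (th / 2))%C / sin (th / 2).

Lemma rpow_snd (x th : R) : snd (rpow x th) = exp (- (x * mu th)) * sin (x * phi th).
Proof. unfold rpow, cis, Cmult, RtoC; cbn [fst snd]. ring. Qed.

Lemma rpow_fst (x th : R) : fst (rpow x th) = exp (- (x * mu th)) * cos (x * phi th).
Proof. unfold rpow, cis, Cmult, RtoC; cbn [fst snd]. ring. Qed.

Lemma is_derive_rpow_snd (x th : R) :
  is_derive (fun t => snd (rpow x t)) th
    (- x * (2 * sin th / denom th * snd (rpow x th) +
            6 * (1 - cos th) / denom th * fst (rpow x th))).
Proof.
  apply is_derive_ext with (fun t => exp (- (x * mu t)) * sin (x * phi t)).
  { intros t. symmetry. apply rpow_snd. }
  rewrite rpow_snd, rpow_fst.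
  pose proof (is_derive_mu th) as Hm. pose proof (is_derive_phi th) as Hp.
  auto_derive.
  - repeat split; eexists; eassumption.
  - change (Derive (fun t : R => mu t) th) with (Derive mu th).
    change (Derive (fun t : R => phi t) th) with (Derive phi th).
    rewrite (is_derive_unique mu _ _ Hm), (is_derive_unique phi _ _ Hp). ring.
Qed.

Lemma half_angle (th : R) :
  1 - cos th = 2 * (sin (th / 2) * sin (th / 2)) /\ sin th = 2 * sin (th / 2) * cos (th / 2).
Proof.
  replace th with (2 * (th / 2)) at 1 4 by field.
  rewrite cos_2a_sin, sin_2a. split; ring.
Qed.

(* The difference is an exact derivative, so up to boundary terms the integral of [ref_kernel]
   is the same at x and x + 1; as it tends to 0 when x grows, it is tiny. *)
Lemma ref_kernel_step (x th : R) : x <> 0 -> sin (th / 2) <> 0 ->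
  ref_kernel x th - ref_kernel (x + 1) th =
  - / x * (- x * (2 * sin th / denom th * snd (rpow x th) +
            6 * (1 - cos th) / denom th * fst (rpow x th))).
Proof.
  intros Hx Hs. unfold ref_kernel. rewrite rpow_add.
  destruct (rpow_1 th) as [Ha Hb]. destruct (rpow 1 th) as [a b]. cbn [fst snd] in Ha, Hb.
  destruct (rpow x th) as [p q]. unfold Cmult, cis; cbn [fst snd].
  destruct (half_angle th) as [Hc Hsn]. rewrite cos_2a, sin_2a in *.
  pose proof (denom_range th) as Hd. pose proof (sin2_cos2 (th / 2)) as Hsc. unfold Rsqr in Hsc.
  set (S := sin (th / 2)) in *. set (K := cos (th / 2)) in *.
  assert (E1 : cos th = 1 - 2 * (S * S)) by lra.
  assert (HK : K * K = 1 - S * S) by lra.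
  assert (Ha' : a = 1 - 2 * (2 * (S * S)) * (1 + 2 * (S * S)) / denom th).
  { rewrite Ha, Hsn, E1. unfold denom in *. rewrite E1 in *.
    replace (2 * S * K * (2 * S * K)) with (4 * (S * S) * (K * K)) by ring.
    rewrite HK. field. lra. }
  assert (Hb' : b = - (2 * (2 * S * K) * (2 * (S * S)) / denom th)).
  { rewrite Hb, Hsn, E1. field. lra. }
  rewrite Hsn, Hc, Ha', Hb'.
  match goal with |- ?l = ?r => replace r with
    ((4 * (S * S) * K / denom th * q + 12 * (S * S * S) / denom th * p) / S) by (field; lra)
  end.
  match goal with |- ?l = ?r => replace l with
    ((4 * (S * S) / denom th * (q * K * (1 + 2 * (S * S)) - q * (2 * (S * S) * K)  +
       p * (2 * S * (K * K)) + p * S * (1 + 2 * (S * S)))) / S) by (field; lra)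
  end.
  rewrite HK. field. lra.
Qed.

Lemma ref_kernel_continuous (x th : R) : sin (th / 2) <> 0 -> continuous (ref_kernel x) th.
Proof.
  intros Hs. apply (ex_derive_continuous (ref_kernel x)).
  apply ex_derive_ext with (fun t => (exp (- (x * mu t)) * cos (x * phi t) * sin (t / 2) +
     exp (- (x * mu t)) * sin (x * phi t) * cos (t / 2)) / sin (t / 2)).
  { intros t. unfold ref_kernel, rpow, cis, Cmult, RtoC; cbn [fst snd]. do 2 f_equal; ring. }
  pose proof (is_derive_mu th) as Hm. pose proof (is_derive_phi th) as Hp.
  auto_derive. repeat split; try (eexists; eassumption); try exact Hs.
Qed.

Lemma Im_le_Cmod (z : C) : Rabs (snd z) <= Cmod z.
Proof.
  apply Rle_trans with (2 := Rmax_Cmod z). apply Rmax_r.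
Qed.

Lemma mu_increasing (a b : R) : 0 <= a <= b -> b <= PI -> mu a <= mu b.
Proof.
  intros Hab Hb. unfold mu. pose proof (denom_range a).
  assert (cos b <= cos a) by (apply cos_decr_1; lra).
  assert (ln (denom a) <= ln (denom b)) by (apply ln_le; unfold denom in *; lra). lra.
Qed.

Lemma one_minus_exp_ge (u : R) : 0 <= u <= 1 -> u / 2 <= 1 - exp (- u).
Proof.
  intros Hu. rewrite exp_Ropp. pose proof (exp_ineq1_le u).
  assert (/ exp u <= / (1 + u)) by (apply Rinv_le_contravar; lra).
  assert (u / 2 <= 1 - / (1 + u)).
  { replace (1 - / (1 + u)) with (u * / (1 + u)) by (field; lra).
    apply Rmult_le_compat_l; [lra|]. apply Rinv_le_contravar; lra. }
  lra.
Qed.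

Lemma mu_ge_half_sq (th : R) : 0 <= th <= / 4 -> th * th / 2 <= mu th <= 1.
Proof.
  intros Hth. pose proof (mu_bounds th ltac:(lra)).
  assert (0 <= th * th <= / 16) by nra.
  replace (3 * th * th * th * th) with (3 * (th * th) * (th * th)) in * by ring. nra.
Qed.

Section RefKernelIntegral.

Variables (e T : R).
Hypothesis (He : 0 < e) (HeT : e <= T) (HT : T <= / 4).

Lemma sin_half_pos (t : R) : e <= t <= T -> 0 < sin (t / 2).
Proof. intros Ht. pose proof PI2_3_2. unfold PI2 in *. apply sin_gt_0; lra. Qed.

Lemma ref_kernel_ex_RInt (x : R) : ex_RInt (ref_kernel x) e T.
Proof.
  apply (ex_RInt_continuous (V := R_CompleteNormedModule)). intros t Ht.
  rewrite Rmin_left, Rmax_right in Ht by lra.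
  apply ref_kernel_continuous, Rgt_not_eq, sin_half_pos, Ht.
Qed.

Lemma ref_kernel_integral_step (x : R) : 0 < x ->
  RInt (ref_kernel x) e T - RInt (ref_kernel (x + 1)) e T =
  - / x * (snd (rpow x T) - snd (rpow x e)).
Proof.
  intros Hx.
  assert (H : is_RInt (fun t => - x * (2 * sin t / denom t * snd (rpow x t) +
            6 * (1 - cos t) / denom t * fst (rpow x t))) e T
            (minus (snd (rpow x T)) (snd (rpow x e)))).
  { apply (is_RInt_derive (fun t => snd (rpow x t))).
    - intros t _. apply is_derive_rpow_snd.
    - intros t _.
      apply (ex_derive_continuous (fun t => - x * (2 * sin t / denom t * snd (rpow x t) +
            6 * (1 - cos t) / denom t * fst (rpow x t)))).
      apply ex_derive_ext with (fun t => - x * (2 * sin t / (5 - 4 * cos t) *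
            (exp (- (x * mu t)) * sin (x * phi t)) +
            6 * (1 - cos t) / (5 - 4 * cos t) * (exp (- (x * mu t)) * cos (x * phi t)))).
      { intros u. rewrite rpow_snd, rpow_fst. reflexivity. }
      pose proof (is_derive_mu t) as Hm. pose proof (is_derive_phi t) as Hp.
      pose proof (denom_range t). unfold denom in *.
      auto_derive. repeat split; try (eexists; eassumption); lra. }
  apply (is_RInt_scal _ _ _ (- / x)) in H.
  assert (H2 : is_RInt (fun t => minus (ref_kernel x t) (ref_kernel (x + 1) t)) e T
    (scal (- / x) (minus (snd (rpow x T)) (snd (rpow x e))))).
  { apply is_RInt_ext with (2 := H). intros t Ht.
    rewrite Rmin_left, Rmax_right in Ht by lra.
    symmetry. apply ref_kernel_step; [lra|]. apply Rgt_not_eq, sin_half_pos. lra. }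
  pose proof (is_RInt_minus _ _ _ _ _ _ (RInt_correct _ _ _ (ref_kernel_ex_RInt x))
    (RInt_correct _ _ _ (ref_kernel_ex_RInt (x + 1)))) as H3.
  apply (is_RInt_unique (V := R_CompleteNormedModule)) in H2.
  apply (is_RInt_unique (V := R_CompleteNormedModule)) in H3.
  exact (eq_trans (eq_sym H3) H2).
Qed.

Lemma ref_kernel_integral_small (x : R) : 0 <= x ->
  Rabs (RInt (ref_kernel x) e T) <= T / sin (e / 2) * exp (- (x * mu e)).
Proof.
  intros Hx.
  assert (Hs : 0 < sin (e / 2)) by (apply sin_half_pos; lra).
  pose proof (exp_pos (- (x * mu e))) as Hexp.
  assert (Hb : 0 < exp (- (x * mu e)) * / sin (e / 2))
    by (apply Rmult_lt_0_compat; [lra|now apply Rinv_0_lt_compat]).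
  apply Rle_trans with ((T - e) * (exp (- (x * mu e)) * / sin (e / 2))).
  2:{ unfold Rdiv. nra. }
  apply abs_RInt_le_const; [lra|apply ref_kernel_ex_RInt|].
  intros t Ht. unfold ref_kernel.
  pose proof PI2_3_2 as Hpi. unfold PI2 in Hpi.
  assert (Hst : sin (e / 2) <= sin (t / 2)) by (apply sin_incr_1; lra).
  rewrite Rabs_div, (Rabs_right (sin (t / 2))) by lra.
  apply Rmult_le_compat; [apply Rabs_pos|apply Rlt_le, Rinv_0_lt_compat; lra| |].
  - apply Rle_trans with (1 := Im_le_Cmod _).
    rewrite Cmod_mult, Cmod_cis, Cmod_rpow, Rmult_1_r.
    pose proof (mu_increasing e t ltac:(lra) ltac:(lra)).
    destruct (Rle_lt_or_eq_dec (x * mu e) (x * mu t)) as [H'|H'];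
      [now apply Rmult_le_compat_l|left; apply exp_increasing; lra|rewrite H'; lra].
  - apply Rinv_le_contravar; lra.
Qed.

(** Let I x be the integral. The boundary terms for x0, x0 + 1, ... are dominated by geometric
    series with ratios [qT] and [qe], and [b] is their explicit sum. So |I x| - b x does not
    decrease when x goes to x + 1, while I tends to 0; hence |I x0| <= b x0. At the lower end |sin
    (x phi e)| / x <= |phi e| is of order e^3 and 1 - qe of order e^2, which leaves O(e); e > 0 only
    keeps away from the zero of sin (th / 2) and is sent to 0 later. *)
Lemma ref_kernel_integral_bound (x0 : R) : 0 < x0 ->
  Rabs (RInt (ref_kernel x0) e T) <= 4 * exp (- (x0 * (T * T / 2))) / (x0 * (T * T)) + 12 * e.
Proof.
  intros Hx0.
  pose proof (mu_ge_half_sq e ltac:(lra)) as Hme. pose proof (mu_ge_half_sq T ltac:(lra)) as HmT.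
  assert (He2 : 0 < e * e) by nra. assert (HT2 : 0 < T * T) by nra.
  pose proof (one_minus_exp_ge (mu e) ltac:(lra)) as Hqe.
  pose proof (one_minus_exp_ge (mu T) ltac:(lra)) as HqT.
  set (qe := exp (- mu e)) in *. set (qT := exp (- mu T)) in *.
  pose proof (phi_bound e ltac:(lra)) as Hphi.
  set (b := fun x => exp (- (x * mu T)) / (x0 * (1 - qT)) +
                     Rabs (phi e) * exp (- (x * mu e)) / (1 - qe)).
  assert (Hb0 : forall x, 0 <= b x).
  { intros x. unfold b. pose proof (exp_pos (- (x * mu T))). pose proof (exp_pos (- (x * mu e))).
    pose proof (Rabs_pos (phi e)).
    apply Rplus_le_le_0_compat; apply Rmult_le_pos; try (apply Rmult_le_pos; lra);
      try lra; apply Rlt_le, Rinv_0_lt_compat; try lra.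
    apply Rmult_lt_0_compat; lra. }
  assert (Hstep : forall x, x0 <= x ->
    Rabs (RInt (ref_kernel x) e T) - b x <=
    Rabs (RInt (ref_kernel (x + 1)) e T) - b (x + 1)).
  { intros x Hx. pose proof (ref_kernel_integral_step x ltac:(lra)) as E.
    assert (Eb : b x - b (x + 1) = exp (- (x * mu T)) / x0 + Rabs (phi e) * exp (- (x * mu e))).
    { unfold b.
      replace (- ((x + 1) * mu T)) with (- (x * mu T) + - mu T) by ring.
      replace (- ((x + 1) * mu e)) with (- (x * mu e) + - mu e) by ring.
      rewrite !exp_plus. fold qT qe. field. repeat split; lra. }
    enough (Hle : Rabs (- / x * (snd (rpow x T) - snd (rpow x e))) <= b x - b (x + 1)).
    { rewrite <- E in Hle.
      pose proof (Rabs_triang_inv (RInt (ref_kernel x) e T) (RInt (ref_kernel (x + 1)) e T)).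
      lra. }
    rewrite Eb. replace (- / x * (snd (rpow x T) - snd (rpow x e))) with
      (- (/ x * snd (rpow x T)) + / x * snd (rpow x e)) by ring.
    apply Rle_trans with (1 := Rabs_triang _ _). rewrite Rabs_Ropp, !Rabs_mult.
    assert (Hix : 0 < / x <= / x0)
      by (split; [apply Rinv_0_lt_compat; lra|apply Rinv_le_contravar; lra]).
    rewrite (Rabs_right (/ x)) by lra.
    apply Rplus_le_compat.
    - pose proof (Im_le_Cmod (rpow x T)) as H. rewrite Cmod_rpow in H.
      unfold Rdiv. rewrite (Rmult_comm (exp _)).
      apply Rmult_le_compat; try apply Rabs_pos; lra.
    - rewrite rpow_snd, Rabs_mult, (Rabs_right (exp _)) by apply Rle_ge, Rlt_le, exp_pos.
      pose proof (exp_pos (- (x * mu e))).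
      assert (Hsin : Rabs (sin (x * phi e)) <= x * Rabs (phi e)).
      { rewrite <- (Rabs_right x) at 2 by lra. rewrite <- Rabs_mult. apply Rabs_sin_le. }
      replace (Rabs (phi e) * exp (- (x * mu e))) with
        (/ x * (exp (- (x * mu e)) * (x * Rabs (phi e)))) by (field; lra).
      apply Rmult_le_compat_l; [lra|]. apply Rmult_le_compat_l; lra. }
  assert (Hiter : forall n, Rabs (RInt (ref_kernel x0) e T) - b x0 <=
    Rabs (RInt (ref_kernel (x0 + INR n)) e T) - b (x0 + INR n)).
  { induction n as [|n IH]; [cbn; rewrite Rplus_0_r; lra|].
    apply Rle_trans with (1 := IH). rewrite S_INR, <- Rplus_assoc. apply Hstep.
    pose proof (pos_INR n). lra. }
  assert (Hs : 0 < sin (e / 2)) by (apply sin_half_pos; lra).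
  assert (Hfin : Rabs (RInt (ref_kernel x0) e T) <= b x0).
  { apply le_epsilon. intros d Hd.
    assert (Hqe1 : Rabs qe < 1).
    { assert (0 < qe) by apply exp_pos. rewrite Rabs_right; lra. }
    destruct (pow_lt_1_zero qe Hqe1 (d * (sin (e / 2) / T))) as [n Hn].
    { apply Rmult_lt_0_compat; [lra|]. apply Rdiv_lt_0_compat; lra. }
    specialize (Hn n (Nat.le_refl n)). specialize (Hiter n). pose proof (Hb0 (x0 + INR n)).
    pose proof (ref_kernel_integral_small (x0 + INR n) ltac:(pose proof (pos_INR n); lra)) as Hsm.
    assert (Hexp : exp (- ((x0 + INR n) * mu e)) <= qe ^ n).
    { replace (- ((x0 + INR n) * mu e)) with (- (x0 * mu e) + INR n * - mu e) by ring.
      rewrite exp_plus. unfold qe. rewrite <- Rpower_pow by apply exp_pos.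
      unfold Rpower. rewrite ln_exp.
      assert (exp (- (x0 * mu e)) <= 1).
      { rewrite <- exp_0. left. apply exp_increasing. nra. }
      pose proof (exp_pos (INR n * - mu e)). nra. }
    assert (HTs : 0 < T / sin (e / 2)) by (apply Rdiv_lt_0_compat; lra).
    assert (T / sin (e / 2) * exp (- ((x0 + INR n) * mu e)) <= d).
    { apply Rle_trans with (T / sin (e / 2) * (d * (sin (e / 2) / T))).
      - apply Rmult_le_compat_l; [lra|]. apply Rle_trans with (1 := Hexp).
        apply Rabs_def2 in Hn. lra.
      - right. field. lra. }
    lra. }
  apply Rle_trans with (1 := Hfin). unfold b. apply Rplus_le_compat.
  - replace (4 * exp (- (x0 * (T * T / 2))) / (x0 * (T * T))) with
      (exp (- (x0 * (T * T / 2))) * / (x0 * (T * T / 4))) by (field; lra).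
    unfold Rdiv. apply Rmult_le_compat; [apply Rlt_le, exp_pos| | |].
    + apply Rlt_le, Rinv_0_lt_compat, Rmult_lt_0_compat; lra.
    + destruct (Rle_lt_or_eq_dec (x0 * (T * T / 2)) (x0 * mu T)) as [H'|H'];
        [apply Rmult_le_compat_l; lra|left; apply exp_increasing; lra|].
      unfold Rdiv in H'. rewrite H'. lra.
    + apply Rinv_le_contravar; [apply Rmult_lt_0_compat; lra|].
      apply Rmult_le_compat_l; lra.
  - assert (exp (- (x0 * mu e)) <= 1).
    { rewrite <- exp_0. left. apply exp_increasing. nra. }
    pose proof (exp_pos (- (x0 * mu e))). pose proof (Rabs_pos (phi e)).
    apply Rmult_le_reg_r with (1 - qe); [lra|].
    unfold Rdiv. rewrite Rmult_assoc, Rinv_l, Rmult_1_r by lra.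
    apply Rle_trans with (3 * e * e * e * 1); [apply Rmult_le_compat; lra|].
    nra.
Qed.

End RefKernelIntegral.

(** * The lower bound *)

Lemma exp_incr_le (a b : R) : a <= b -> exp a <= exp b.
Proof. intros [H| ->]; [left; now apply exp_increasing|apply Rle_refl]. Qed.

Lemma sin_half_ge (t : R) : 0 <= t <= / 4 -> t / 4 <= sin (t / 2) <= t / 2.
Proof.
  intros Ht. pose proof (sin_ge_cubic (t / 2) ltac:(lra)). pose proof (sin_le_id (t / 2)).
  assert (t / 2 * (t / 2) <= 1) by nra.
  assert (t / 2 * (t / 2) * (t / 2) <= 1 * (t / 2)) by (apply Rmult_le_compat_r; lra). lra.
Qed.

Lemma kernel_eq (l : list bool) (t : R) : sin (t / 2) <> 0 ->
  fst (kernel l) 0%Z t = snd (fst (gamma t l) * cis (t / 2))%C / sin (t / 2).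
Proof.
  intros Hs. destruct (kernel_sin l 0 t) as [H _].
  replace ((/ 2 - IZR 0) * t) with (t / 2) in H by field. rewrite <- H. field. exact Hs.
Qed.

(** On this range 1 - cos T >= T^2 / 4, and the gain in [rho] is a 24th of it. *)
Lemma rho_pow_bound (T : R) (n : nat) : 0 <= T <= / 4 ->
  rho T ^ n <= exp (- (INR n * (T * T / 96))).
Proof.
  intros HT. pose proof (one_minus_cos_ge T ltac:(lra)) as Hc.
  pose proof (COS_bound T).
  assert (HTT : 0 <= T * T <= 1) by nra.
  replace (T * T * T * T) with (T * T * (T * T)) in Hc by ring.
  assert (T * T * (T * T) <= T * T * 1) by (apply Rmult_le_compat_l; lra).
  apply Rle_trans with (exp (- (T * T / 96)) ^ n).
  - apply pow_incr. unfold rho. pose proof (exp_ineq1_le (- (T * T / 96))). lra.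
  - right. rewrite <- Rpower_pow by apply exp_pos. unfold Rpower. rewrite ln_exp. f_equal. ring.
Qed.

(** Both [rho] and 1 / sin (t / 2) are largest at t = T on [T, PI]. The factor 16 comes from PI <= 4
    and sin (T / 2) >= T / 4. *)
Lemma kernel_tail_bound (l : list bool) (T : R) : 0 < T <= / 4 ->
  Rabs (RInt (fst (kernel l) 0%Z) T PI) <=
  16 / T * exp (- (INR (descents l) * (T * T / 96))).
Proof.
  intros HT. pose proof PI2_3_2 as Hpi. unfold PI2 in Hpi. pose proof PI_4 as Hpi4.
  pose proof (sin_half_ge T ltac:(lra)) as HsT.
  set (E := exp (- (INR (descents l) * (T * T / 96)))).
  assert (HE : 0 < E) by apply exp_pos.
  assert (HET : 0 < E * (4 / T)) by (apply Rmult_lt_0_compat; [|apply Rdiv_lt_0_compat]; lra).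
  apply Rle_trans with ((PI - T) * (E * (4 / T))).
  2:{ apply Rle_trans with (4 * (E * (4 / T))); [apply Rmult_le_compat_r; lra|].
      right. field. lra. }
  apply abs_RInt_le_const; [lra|apply (proj1 (kernel_ex_RInt l 0 T PI))|].
  intros t Ht.
  assert (Hst : sin (T / 2) <= sin (t / 2)) by (apply sin_incr_1; lra).
  rewrite kernel_eq by lra. rewrite Rabs_div, (Rabs_right (sin (t / 2))) by lra.
  unfold Rdiv at 1. apply Rmult_le_compat.
  - apply Rabs_pos.
  - apply Rlt_le, Rinv_0_lt_compat; lra.
  - apply Rle_trans with (1 := Im_le_Cmod _). rewrite Cmod_mult, Cmod_cis, Rmult_1_r.
    apply Rle_trans with (1 := proj1 (gamma_bound t l)).
    apply Rle_trans with (2 := rho_pow_bound T (descents l) ltac:(lra)).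
    apply pow_incr. unfold rho. pose proof (COS_bound t).
    assert (cos t <= cos T) by (apply cos_decr_1; lra). lra.
  - replace (4 / T) with (/ (T / 4)) by (field; lra). apply Rinv_le_contravar; lra.
Qed.

Lemma error_scale_le (t T B : R) (m : nat) : 0 < t <= T -> 0 <= B ->
  error_scale t B m * (4 / t) <= 1600 * (1 + INR m) * (T * T * T + B * (T * T * T * T * T)).
Proof.
  intros Ht HB. unfold error_scale. pose proof (pos_INR m).
  replace (400 * (1 + INR m) * (t * t * t * t + B * (t * t * t * t * t * t)) * (4 / t)) with
    (1600 * (1 + INR m) * (t * t * t + B * (t * t * t * t * t))) by (field; lra).
  apply Rmult_le_compat_l; [lra|].
  assert (Hp : forall n, t ^ n <= T ^ n) by (intros; apply pow_incr; lra).
  pose proof (Hp 3%nat). pose proof (Hp 5%nat).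
  apply Rplus_le_compat; [cbn in *; lra|].
  apply Rmult_le_compat_l; [lra|cbn in *; lra].
Qed.

Lemma kernel_pointwise (l : list bool) (T t : R) (m : nat) :
  let nu := fst (fst (cum l)) in
  let W := snd (fst (cum l)) in
  0 < t <= T -> T <= / 4 -> nu * (T * T * T) <= / 6 ->
  ref_kernel nu t + W / 6 * (t * t * exp (- (nu * (t * t)))) -
    1600 * (1 + INR m) * (T * T * T + 12 * (nu + 1) * (T * T * T * T * T)) * (W + nu / 2 ^ m)
  <= fst (kernel l) 0%Z t.
Proof.
  intros nu W Ht HT Hnu3.
  pose proof (cum_nu_dist l) as HD. pose proof (cum_W_range l) as HW.
  (* The bound has to cover both components of the pair, and the first entry for t + 1 is at most nu
     + 1. *)
  pose proof (gamma_approx t (12 * (nu + 1)) m l ltac:(lra)) as Happ.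
  unfold nu, W in *. clear nu W.
  destruct (cum l) as [[nu W] [nb Wb]]. cbn [fst snd] in *.
  assert (Hnu : 0 <= nu) by lra.
  destruct (Happ ltac:(lra) ltac:(lra)) as [Herr _]. clear Happ.
  pose proof (sin_half_ge t ltac:(lra)) as Hs.
  rewrite kernel_eq by lra. unfold error_at in Herr.
  set (E := (fst (gamma t l) - approx t (nu, W))%C) in *.
  replace (fst (gamma t l)) with (approx t (nu, W) + E)%C by (unfold E; ring).
  assert (Hex : 0 < / 2 ^ m) by (apply Rinv_0_lt_compat, pow_lt; lra).
  assert (HWnu : 0 <= W + nu / 2 ^ m).
  { unfold Rdiv. assert (0 <= nu * / 2 ^ m) by (apply Rmult_le_pos; lra). lra. }
  assert (Hsplit : snd ((approx t (nu, W) + E) * cis (t / 2))%C / sin (t / 2) =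
    ref_kernel nu t +
    W * (t * t * t / 6) * (exp (- (nu * mu t)) * cos (nu * phi t + t / 2)) / sin (t / 2) +
    snd (E * cis (t / 2))%C / sin (t / 2)).
  { unfold ref_kernel, approx; cbn [fst snd]. rewrite cos_plus.
    pose proof (rpow_fst nu t) as H1. pose proof (rpow_snd nu t) as H2.
    destruct (rpow nu t) as [p q]. cbn [fst snd] in H1, H2.
    replace (exp (- (nu * mu t)) * (cos (nu * phi t) * cos (t / 2) -
      sin (nu * phi t) * sin (t / 2))) with (p * cos (t / 2) - q * sin (t / 2))
      by (rewrite H1, H2; ring).
    destruct E as [E1 E2]. unfold Cmult, Cplus, Ci, RtoC, cis; cbn [fst snd]. field. lra. }
  rewrite Hsplit.
  assert (Herr2 : - (1600 * (1 + INR m) * (T * T * T + 12 * (nu + 1) * (T * T * T * T * T)) *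
      (W + nu / 2 ^ m)) <= snd (E * cis (t / 2))%C / sin (t / 2)).
  { pose proof (Im_le_Cmod (E * cis (t / 2))%C) as H.
    rewrite Cmod_mult, Cmod_cis, Rmult_1_r in H.
    assert (HE : Rabs (snd (E * cis (t / 2))%C / sin (t / 2)) <=
      error_scale t (12 * (nu + 1)) m * (W + nu / 2 ^ m) * (4 / t)).
    { rewrite Rabs_div, (Rabs_right (sin (t / 2))) by lra.
      unfold Rdiv at 1. apply Rmult_le_compat; [apply Rabs_pos| |lra|].
      - apply Rlt_le, Rinv_0_lt_compat; lra.
      - replace (4 / t) with (/ (t / 4)) by (field; lra). apply Rinv_le_contravar; lra. }
    pose proof (error_scale_le t T (12 * (nu + 1)) m Ht ltac:(lra)) as Hsc.
    apply (Rmult_le_compat_r (W + nu / 2 ^ m)) in Hsc; [|exact HWnu].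
    apply Rabs_le_between in HE. lra. }
  (* The phase is at most 3 nu T^3 + t / 2 <= 1, hence its cosine is at least 1/2; with sin (t / 2)
     <= t / 2 the constants cancel to W t^2 / 6. *)
  assert (Hmain : W / 6 * (t * t * exp (- (nu * (t * t)))) <=
    W * (t * t * t / 6) * (exp (- (nu * mu t)) * cos (nu * phi t + t / 2)) / sin (t / 2)).
  { pose proof (phi_bound t ltac:(lra)) as Hphi.
    assert (Ht3 : t * t * t <= T * T * T).
    { replace (t * t * t) with (t ^ 3) by ring. replace (T * T * T) with (T ^ 3) by ring.
      apply pow_incr; lra. }
    assert (Harg : Rabs (nu * phi t + t / 2) <= 1).
    { apply Rle_trans with (1 := Rabs_triang _ _).
      rewrite Rabs_mult, (Rabs_right nu), (Rabs_right (t / 2)) by lra.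
      assert (nu * Rabs (phi t) <= nu * (3 * (T * T * T)))
        by (apply Rmult_le_compat_l; lra). lra. }
    assert (Hcos : 1 / 2 <= cos (nu * phi t + t / 2)).
    { pose proof (one_minus_cos_le (nu * phi t + t / 2)).
      apply Rabs_le_between in Harg. nra. }
    pose proof (mu_bounds t ltac:(lra)) as Hmu.
    assert (He : exp (- (nu * (t * t))) <= exp (- (nu * mu t))).
    { apply exp_incr_le, Ropp_le_contravar, Rmult_le_compat_l; lra. }
    pose proof (exp_pos (- (nu * (t * t)))) as He0.
    apply Rle_trans with (W * (t * t * t / 6) * (exp (- (nu * (t * t))) * (1 / 2)) / (t / 2)).
    - right. field. lra.
    - unfold Rdiv at 1 6.
      assert (0 <= t * t * t) by (repeat apply Rmult_le_pos; lra).
      apply Rmult_le_compat.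
      + repeat apply Rmult_le_pos; lra.
      + apply Rlt_le, Rinv_0_lt_compat; lra.
      + apply Rmult_le_compat_l; [apply Rmult_le_pos; lra|].
        apply Rmult_le_compat; lra.
      + apply Rinv_le_contravar; lra. }
  lra.
Qed.

(** With s = 1 / sqrt nu, only [s/2, s] is kept: there the integrand is at least (s^2 / 4) e^(-1) >=
    s^2 / 12. *)
Lemma main_term_integral (nu e T : R) :
  0 < nu -> 0 < e -> 2 * e <= / sqrt nu -> / sqrt nu <= T ->
  / sqrt nu * / sqrt nu * / sqrt nu / 24 <= RInt (fun t => t * t * exp (- (nu * (t * t)))) e T.
Proof.
  intros Hnu He Hes HsT. set (s := / sqrt nu) in *.
  assert (Hsn : 0 < sqrt nu) by now apply sqrt_lt_R0.
  assert (Hs0 : 0 < s) by now apply Rinv_0_lt_compat.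
  assert (Hss : nu * (s * s) = 1).
  { unfold s. rewrite <- (sqrt_sqrt nu) at 1 by lra. field. lra. }
  set (g := fun t => t * t * exp (- (nu * (t * t)))).
  assert (Hex : forall a b, ex_RInt g a b).
  { intros a b. apply (ex_RInt_continuous (V := R_CompleteNormedModule)). intros t _.
    apply (ex_derive_continuous g). unfold g. auto_derive. exact I. }
  assert (Hg0 : forall t, 0 <= g t).
  { intros t. unfold g. pose proof (exp_pos (- (nu * (t * t)))).
    apply Rmult_le_pos; [nra|lra]. }
  rewrite <- (RInt_Chasles g e (s / 2) T), <- (RInt_Chasles g (s / 2) s T) by apply Hex.
  assert (H1 : 0 <= RInt g e (s / 2)) by (apply RInt_ge_0; auto; lra).
  assert (H2 : 0 <= RInt g s T) by (apply RInt_ge_0; auto; lra).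
  assert (H3 : s * s * s / 24 <= RInt g (s / 2) s).
  { apply Rle_trans with (RInt (fun _ => s * s / 12) (s / 2) s).
    - rewrite RInt_const. right. unfold scal; cbn. unfold mult; cbn. field.
    - apply RInt_le; [lra|apply ex_RInt_const|apply Hex|]. intros t Ht. unfold g.
      assert (Hexp : / 3 <= exp (- (nu * (t * t)))).
      { apply Rle_trans with (exp (- (1))).
        - rewrite exp_Ropp. apply Rinv_le_contravar; [apply exp_pos|apply exp_le_3].
        - apply exp_incr_le, Ropp_le_contravar. rewrite <- Hss.
          apply Rmult_le_compat_l; [lra|]. apply Rmult_le_compat; lra. }
      apply Rle_trans with ((s / 2 * (s / 2)) * / 3); [right; field|].
      apply Rmult_le_compat; try lra; [apply Rmult_le_pos; lra|].
      apply Rmult_le_compat; lra. }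
  change (s * s * s / 24 <= RInt g e (s / 2) + (RInt g (s / 2) s + RInt g s T)). lra.
Qed.

Lemma kernel_integral_lower (l : list bool) (T : R) (m : nat) :
  let nu := fst (fst (cum l)) in
  let W := snd (fst (cum l)) in
  0 < nu -> 12 <= W -> / sqrt nu <= T -> T <= / 4 -> nu * (T * T * T) <= / 6 ->
  W * (/ sqrt nu * / sqrt nu * / sqrt nu) / 144 -
  1600 * (1 + INR m) * (T * T * T + 12 * (nu + 1) * (T * T * T * T * T)) * (W + nu / 2 ^ m) * T -
  4 * exp (- (nu * (T * T / 2))) / (nu * (T * T)) -
  16 / T * exp (- (INR (descents l) * (T * T / 96))) <= RInt (fst (kernel l) 0%Z) 0 PI.
Proof.
  intros nu W Hnu HW HsT HT Hnu3.
  pose proof (fun t => kernel_pointwise l T t m) as Hpt. cbv zeta in Hpt. fold nu W in Hpt.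
  set (Q := 1600 * (1 + INR m) * (T * T * T + 12 * (nu + 1) * (T * T * T * T * T)) *
    (W + nu / 2 ^ m)) in *.
  set (f := fst (kernel l) 0%Z) in *.
  assert (Hf : forall a b, ex_RInt f a b) by (intros; apply (proj1 (kernel_ex_RInt l 0 a b))).
  assert (Hs0 : 0 < / sqrt nu) by (apply Rinv_0_lt_compat, sqrt_lt_R0, Hnu).
  assert (HQ : 0 <= Q).
  { unfold Q. pose proof (pos_INR m).
    assert (0 < / 2 ^ m) by (apply Rinv_0_lt_compat, pow_lt; lra).
    repeat apply Rmult_le_pos; try lra.
    - apply Rplus_le_le_0_compat; repeat apply Rmult_le_pos; lra.
    - unfold Rdiv. assert (0 <= nu * / 2 ^ m) by (apply Rmult_le_pos; lra). lra. }
  set (M := 6 * (IZR (Z.abs 0) + INR (length l)) + 11).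
  assert (HM : 0 < M) by (unfold M; cbn; pose proof (pos_INR (length l)); lra).
  apply le_epsilon. intros d Hd.
  set (e := Rmin (/ sqrt nu / 2) (d / (12 + M))).
  assert (He : 0 < e).
  { unfold e. apply Rmin_glb_lt; [lra|]. apply Rdiv_lt_0_compat; lra. }
  assert (He1 : e <= / sqrt nu / 2) by apply Rmin_l.
  assert (He2 : e * (12 + M) <= d).
  { apply Rle_trans with (d / (12 + M) * (12 + M)).
    - apply Rmult_le_compat_r; [lra|]. apply Rmin_r.
    - right. field. lra. }
  rewrite <- (RInt_Chasles f 0 e PI), <- (RInt_Chasles f e T PI) by apply Hf.
  assert (H1 : Rabs (RInt f 0 e) <= (e - 0) * M).
  { apply abs_RInt_le_const; [lra|apply Hf|]. intros t _. apply kernel_bound. }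
  pose proof (kernel_tail_bound l T ltac:(lra)) as H2. fold f in H2.
  pose proof (ref_kernel_integral_bound e T ltac:(lra) ltac:(lra) HT nu Hnu) as H3.
  pose proof (main_term_integral nu e T Hnu He ltac:(lra) HsT) as H4.
  set (g := fun t => t * t * exp (- (nu * (t * t)))) in *.
  assert (Hg : ex_RInt g e T).
  { apply (ex_RInt_continuous (V := R_CompleteNormedModule)). intros t _.
    apply (ex_derive_continuous g). unfold g. auto_derive. exact I. }
  assert (H5 : RInt (ref_kernel nu) e T + W / 6 * RInt g e T - Q * T <= RInt f e T).
  { assert (Hr : is_RInt (fun t => plus (plus (ref_kernel nu t) (scal (W / 6) (g t))) (- Q)) e T
      (plus (plus (RInt (ref_kernel nu) e T) (scal (W / 6) (RInt g e T))) (scal (T - e) (- Q)))).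
    { apply (is_RInt_plus (V := R_NormedModule)).
      - apply (is_RInt_plus (V := R_NormedModule)).
        + apply (RInt_correct (V := R_CompleteNormedModule)), ref_kernel_ex_RInt; lra.
        + apply (is_RInt_scal (V := R_NormedModule)).
          apply (RInt_correct (V := R_CompleteNormedModule)), Hg.
      - apply (is_RInt_const (V := R_NormedModule)). }
    pose proof (is_RInt_unique (V := R_CompleteNormedModule) _ _ _ _ Hr) as E.
    apply Rle_trans with (RInt (fun t => plus (plus (ref_kernel nu t) (scal (W / 6) (g t))) (- Q))
      e T).
    - rewrite E. change (RInt (ref_kernel nu) e T + W / 6 * RInt g e T - Q * T <=
        RInt (ref_kernel nu) e T + W / 6 * RInt g e T + (T - e) * - Q).
      assert (0 <= e * Q) by (apply Rmult_le_pos; lra). lra.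
    - apply RInt_le; [lra|eexists; exact Hr|apply Hf|]. intros t Ht.
      specialize (Hpt t ltac:(lra) HT Hnu3). 
      change (ref_kernel nu t + W / 6 * (t * t * exp (- (nu * (t * t)))) + - Q <= f t). lra. }
  apply Rabs_le_between in H1. apply Rabs_le_between in H2. apply Rabs_le_between in H3.
  assert (H6 : W / 6 * (/ sqrt nu * / sqrt nu * / sqrt nu / 24) <= W / 6 * RInt g e T)
    by (apply Rmult_le_compat_l; lra).
  change (plus (RInt f 0 e) (plus (RInt f e T) (RInt f T PI))) with
    (RInt f 0 e + (RInt f e T + RInt f T PI)). lra.
Qed.

(** * Choice of the scales *)

Lemma exp_opp_sq_bound (x : R) : 0 < x ->
  exp (- (x * x / 384)) <= 6912 ^ 18 * / x ^ 36.
Proof.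
  (* 6912 = 18 * 384, and e^u >= u is raised to the power 18. The resulting x^(-36) still beats the
     main term x^(-27) after multiplication by 1 / T = x^8. *)
  intros Hx. set (u := x * x / 6912).
  assert (Hu : 0 < u) by (unfold u; apply Rdiv_lt_0_compat; nra).
  assert (E : exp (x * x / 384) = exp u ^ 18).
  { rewrite <- Rpower_pow by apply exp_pos. unfold Rpower. rewrite ln_exp. f_equal.
    unfold u. rewrite INR_IZR_INZ. cbn [Z.of_nat]. cbn. field. }
  rewrite exp_Ropp, E.
  apply Rle_trans with (/ u ^ 18).
  - apply Rinv_le_contravar; [now apply pow_lt|]. apply pow_incr.
    pose proof (exp_ineq1_le u). lra.
  - right. unfold u. field. lra.
Qed.

(** An m of order log x would do. The cruder choice of 18 k with k = up x and x <= k <= 2^k costs a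
    factor x, which is affordable: the error of order W x^(-30) becomes W x^(-29). *)
Lemma dyadic_scale (x : R) : 1 <= x ->
  exists m : nat, 1 + INR m <= 37 * x /\ x ^ 18 / 2 ^ m <= 1.
Proof.
  intros Hx. destruct (archimed x) as [H1 H2].
  assert (Hz : (0 <= up x)%Z) by (apply le_IZR; lra).
  set (k := Z.to_nat (up x)).
  assert (Hk : INR k = IZR (up x)) by (unfold k; rewrite INR_IZR_INZ, Z2Nat.id by lia; reflexivity).
  exists (18 * k)%nat. split.
  - rewrite mult_INR, Hk. replace (INR 18) with 18 by (rewrite INR_IZR_INZ; reflexivity). lra.
  - rewrite Nat.mul_comm, pow_mult.
    assert (Hkx : x <= 2 ^ k).
    { apply Rle_trans with (INR k); [lra|]. clear. induction k as [|k IH]; [cbn; lra|].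
      rewrite S_INR. cbn [pow]. assert (1 <= 2 ^ k) by (apply pow_R1_Rle; lra). lra. }
    assert (0 < (2 ^ k) ^ 18) by (do 2 apply pow_lt; lra).
    apply Rle_div_l; [lra|]. rewrite Rmult_1_l. apply pow_incr. lra.
Qed.

(* The main term has size W x^(-27), the error W x^(-29), and the two tails are smaller than
   any power of x. *)
Lemma lower_bound_positive (x W z : R) (m : nat) :
  144 * (2960000 + 20 * 6912 ^ 18) + 2 <= x -> 12 <= W -> (x ^ 18 - 2) / 2 <= z ->
  1 + INR m <= 37 * x -> x ^ 18 / 2 ^ m <= 1 ->
  let T := / x ^ 8 in
  let nu := x ^ 18 in
  0 < W * (/ x ^ 9 * / x ^ 9 * / x ^ 9) / 144 -
  1600 * (1 + INR m) * (T * T * T + 12 * (nu + 1) * (T * T * T * T * T)) * (W + nu / 2 ^ m) * T -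
  4 * exp (- (nu * (T * T / 2))) / (nu * (T * T)) -
  16 / T * exp (- (z * (T * T / 96))).
Proof.
  intros HxX HW Hz Hm Hnum T nu.
  assert (HC : 1 <= 6912 ^ 18) by (apply pow_R1_Rle; lra).
  set (C := 6912 ^ 18) in *.
  assert (Hx : 2 <= x) by lra.
  assert (Hxn : forall n, 0 < x ^ n) by (intros; apply pow_lt; lra).
  assert (Hxinv : forall n, 0 < / x ^ n) by (intros; apply Rinv_0_lt_compat, Hxn).
  assert (HnuT : nu * (T * T) = x * x) by (unfold nu, T; field; lra).
  pose proof (exp_opp_sq_bound x ltac:(lra)) as Hexp. fold C in Hexp.
  set (D := exp (- (x * x / 384))) in *.
  assert (HD : 0 < D) by apply exp_pos.
  assert (A1 : 4 * exp (- (nu * (T * T / 2))) / (nu * (T * T)) <= 4 * x ^ 8 * D).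
  { replace (nu * (T * T / 2)) with (x * x / 2) by (rewrite <- HnuT; field).
    rewrite HnuT. apply Rle_div_l; [nra|].
    assert (exp (- (x * x / 2)) <= D) by (apply exp_incr_le; nra).
    assert (1 <= x ^ 8 * (x * x)) by (replace (x ^ 8 * (x * x)) with (x ^ 10) by ring;
      apply pow_R1_Rle; lra).
    assert (D * 1 <= D * (x ^ 8 * (x * x))) by (apply Rmult_le_compat_l; lra). lra. }
  (* Since T * T = x^(-16), the exponent is at least (x * x - 2) / 192, and this is at least x * x /
     384 because x * x >= 4. *)
  assert (A2 : 16 / T * exp (- (z * (T * T / 96))) <= 16 * x ^ 8 * D).
  { replace (16 / T) with (16 * x ^ 8) by (unfold T; field; lra).
    apply Rmult_le_compat_l; [pose proof (Hxn 8%nat); lra|]. apply exp_incr_le.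
    apply Ropp_le_contravar.
    assert (HTT : 0 < T * T <= 1).
    { unfold T. split; [apply Rmult_lt_0_compat; apply Hxinv|].
      rewrite <- (Rmult_1_r 1). assert (1 <= x ^ 8) by (apply pow_R1_Rle; lra).
      assert (/ x ^ 8 <= 1) by (rewrite <- Rinv_1; apply Rinv_le_contravar; lra).
      pose proof (Hxinv 8%nat). apply Rmult_le_compat; lra. }
    assert ((x ^ 18 - 2) / 2 * (T * T / 96) <= z * (T * T / 96))
      by (apply Rmult_le_compat_r; lra).
    fold nu in H. assert (4 <= x * x) by nra. lra. }
  assert (A3 : x ^ 8 * D <= C * / x ^ 28).
  { apply Rle_trans with (x ^ 8 * (C * / x ^ 36)).
    - apply Rmult_le_compat_l; [apply Rlt_le, Hxn|exact Hexp].
    - right. field. lra. }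
  assert (A4 : 1600 * (1 + INR m) * (T * T * T + 12 * (nu + 1) * (T * T * T * T * T)) *
    (W + nu / 2 ^ m) * T <= 2960000 * W * / x ^ 29).
  (* Here 25 = 1 + 12 * 2, from T^3 <= x^(-22) and (nu + 1) T^5 <= 2 x^(-22), and W + nu / 2^m <= W
     + 1 <= 2 W. The product 1600 * 37 * 25 * 2 is 2960000. *)
  { apply Rle_trans with (1600 * (37 * x) * (25 * / x ^ 22) * (2 * W) * T).
    2:{ right. unfold T. field. lra. }
    pose proof (pos_INR m). pose proof (Hxinv 8%nat) as HT0. fold T in HT0.
    assert (Hnu1 : 1 <= nu) by (apply pow_R1_Rle; lra).
    assert (HT5 : 0 < T * T * T * T * T) by (repeat apply Rmult_lt_0_compat; lra).
    assert (B1 : T * T * T <= / x ^ 22).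
    { replace (T * T * T) with (/ x ^ 24) by (unfold T; field; lra).
      apply Rinv_le_contravar; [apply Hxn|]. apply Rle_pow; [lra|lia]. }
    assert (B2 : (nu + 1) * (T * T * T * T * T) <= 2 * / x ^ 22).
    { apply Rle_trans with (2 * nu * (T * T * T * T * T)).
      - apply Rmult_le_compat_r; lra.
      - right. unfold nu, T. field. lra. }
    assert (B3 : 0 < T * T * T) by (repeat apply Rmult_lt_0_compat; lra).
    assert (B4 : 0 < (nu + 1) * (T * T * T * T * T)) by (apply Rmult_lt_0_compat; lra).
    assert (B5 : 0 < / 2 ^ m) by (apply Rinv_0_lt_compat, pow_lt; lra).
    assert (B6 : 0 <= nu / 2 ^ m) by (unfold Rdiv; apply Rmult_le_pos; lra).
    fold nu in Hnum.
    apply Rmult_le_compat_r; [lra|].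
    apply Rmult_le_compat; [apply Rmult_le_pos; lra|lra| |lra].
    apply Rmult_le_compat; lra. }
  apply Rlt_le_trans with (W * (/ x ^ 9 * / x ^ 9 * / x ^ 9) / 144 - 2960000 * W * / x ^ 29 -
    20 * (C * / x ^ 28)); [|lra].
  replace (W * (/ x ^ 9 * / x ^ 9 * / x ^ 9) / 144 - 2960000 * W * / x ^ 29 -
    20 * (C * / x ^ 28)) with
    (/ x ^ 28 * (W * x / 144 - 2960000 * W * / x - 20 * C)) by (field; lra).
  apply Rmult_lt_0_compat; [apply Hxinv|].
  assert (/ x <= 1) by (rewrite <- Rinv_1; apply Rinv_le_contravar; lra).
  assert (2960000 * W * / x <= 2960000 * W * 1) by (apply Rmult_le_compat_l; lra).
  assert (W * (144 * (2960000 + 20 * C) + 2) <= W * x) by (apply Rmult_le_compat_l; lra).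
  assert (12 * C <= W * C) by (apply Rmult_le_compat_r; lra). lra.
Qed.

(* c_t is the limit of dens t N as N -> oo *)
Theorem theorem1p1 :
  exists M0 : nat, forall t : nat, (M0 <= nblocks t)%nat ->
    exists c : R, is_lim_seq (dens t) c /\ c > 1/2.
Proof.
  (* X is the threshold for x = nu^(1/18) in [lower_bound_positive]. As nu is at least half the
     number of descents, and there is at most one block more than descents, 2 X^18 + 1 blocks
     suffice. *)
  set (X := 144 * (2960000 + 20 * 6912 ^ 18) + 2).
  assert (HC : 1 <= 6912 ^ 18) by (apply pow_R1_Rle; lra).
  assert (HX : 2 <= X) by (unfold X; lra).
  assert (HX18 : 0 < X ^ 18) by (apply pow_lt; lra).
  destruct (archimed (2 * X ^ 18 + 1)) as [HM _].
  exists (Z.to_nat (up (2 * X ^ 18 + 1))). intros t Ht.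
  destruct (value_surj t) as [l <-].
  apply dens_limit_of_kernel.
  assert (Hz : 2 * X ^ 18 <= INR (descents l)).
  { pose proof (nblocks_descents l) as H.
    assert (H' : (Z.to_nat (up (2 * X ^ 18 + 1)) <= descents l + 1)%nat)
      by (destruct (head_digit l); cbn [Nat.b2n] in H; lia).
    apply le_INR in H'. rewrite plus_INR, INR_IZR_INZ, Z2Nat.id in H'.
    - change (INR 1) with 1 in H'. lra.
    - apply le_IZR. lra. }
  pose proof (cum_nu_lower l) as [Hnu1 _]. pose proof (cum_nu_upper l) as Hnu2.
  pose proof (cum_W_range l) as (HW1 & _ & HW2).
  pose proof (kernel_integral_lower l) as Hmain. cbv zeta in *.
  set (nu := fst (fst (cum l))) in *. set (W := snd (fst (cum l))) in *.
  assert (HnuX : X ^ 18 <= nu) by (destruct (head_digit l); lra).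
  assert (HW : 12 <= W).
  { destruct HW2 as [HW2|HW2]; [|exact HW2]. exfalso.
    assert (nu = 0) by (unfold nu; now rewrite HW2). lra. }
  set (x := Rpower nu (/ 18)).
  assert (Hx0 : 0 < x) by apply exp_pos.
  assert (Hx18 : x ^ 18 = nu).
  { rewrite <- Rpower_pow by exact Hx0. unfold x. rewrite Rpower_mult.
    replace (/ 18 * INR 18) with 1 by (rewrite INR_IZR_INZ; cbn; field).
    apply Rpower_1. lra. }
  assert (HxX : X <= x).
  { destruct (Rle_lt_dec X x) as [H|H]; [exact H|exfalso].
    assert (x ^ 18 <= x * X ^ 17).
    { change (x ^ 18) with (x * x ^ 17). apply Rmult_le_compat_l; [lra|]. apply pow_incr. lra. }
    assert (0 < X ^ 17) by (apply pow_lt; lra).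
    assert (x * X ^ 17 < X * X ^ 17) by (apply Rmult_lt_compat_r; lra).
    change (X * X ^ 17) with (X ^ 18) in *. lra. }
  destruct (dyadic_scale x ltac:(lra)) as (m & Hm & Hnum).
  specialize (Hmain (/ x ^ 8) m).
  assert (Hsq : sqrt nu = x ^ 9).
  { rewrite <- Hx18. replace (x ^ 18) with (x ^ 9 * x ^ 9) by ring.
    apply sqrt_square. apply pow_le. lra. }
  rewrite Hsq in Hmain.
  eapply Rlt_le_trans; [|apply Hmain].
  - rewrite <- Hx18. apply lower_bound_positive; try assumption.
    rewrite Hx18. lra.
  - rewrite <- Hx18. apply pow_lt. lra.
  - exact HW.
  - apply Rinv_le_contravar; [apply pow_lt; lra|]. apply Rle_pow; [lra|lia].
  - apply Rinv_le_contravar; [lra|]. apply Rle_trans with (2 ^ 8); [lra|]. apply pow_incr. lra.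
  - rewrite <- Hx18.
    replace (x ^ 18 * (/ x ^ 8 * / x ^ 8 * / x ^ 8)) with (/ x ^ 6) by (field; lra).
    apply Rinv_le_contravar; [lra|]. apply Rle_trans with (2 ^ 6); [lra|]. apply pow_incr. lra.
Qed.
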